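(* Let $\epsilon>0$. There is a polynomial-time $(\epsilon,0)$-differentially private algorithm $\mathcal{A}$ which takes as input a connected graph $G=(V,E,w)$ with $w\in\mathbb{R}_+^{\binom n2}$, $\lambda(G)=\Omega\big(\frac{\Delta(G)\log^2 n}{\epsilon}\big)$ and $\frac{\Delta(G)\log^2 n}{\epsilon\lambda(G)}<\frac12$, and outputs a vector $\widehat C=\mathcal{A}(G)\in\mathbb{R}^{\binom n2}$ such that with high probability, for all distinct $u,v\in V$, $$\big|\widehat C[\{u,v\}]-C_{u,v}(G)\big|=O\!\left(\frac{\|w\|_1}{\lambda^2(G)}\cdot\frac{\Delta(G)\log^2 n}{\epsilon}\right).$$
   Context: Graphs on $n$ vertices are identified with weight vectors $w\in\mathbb{R}_+^{\binom n2}$ (coordinates indexed by unordered vertex pairs); neighboring graphs satisfy $\|w-w'\|_0\le1$, $\|w-w'\|_\infty\le1$, and $(\epsilon,\delta)$-differential privacy means $\Pr[\mathcal{A}(w)\in S]\le e^\epsilon\Pr[\mathcal{A}(w')\in S]+\delta$ for all neighboring $w,w'$ and measurable $S$. $\Delta(G)$ is the maximum unweighted degree, $\lambda(G)$ the smallest non-zero eigenvalue of the Laplacian $L_G=D_G-A_G$. The random walk on $G$ moves from $u$ to a neighbor $v$ with probability $w_{\{u,v\}}/d(u)$ where $d(u)=\sum_{v}w_{\{u,v\}}$. With $X_1,X_2,\dots$ the walk, the hitting time is $h_{u,v}=\mathbb{E}[\min\{t\ge1: X_t=v\}\mid X_1=u]$, and the commute time is $C_{u,v}(G)=h_{u,v}+h_{v,u}$.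 *)

(* Defs.v *)
From HB Require Import structures.
From mathcomp Require Import all_boot all_order all_algebra.
From mathcomp Require Import all_classical all_reals all_analysis.

Set Implicit Arguments.
Unset Strict Implicit.
Unset Printing Implicit Defensive.

Import Order.TTheory GRing.Theory Num.Theory.
Import numFieldNormedType.Exports.

Local Open Scope classical_set_scope.
Local Open Scope ring_scope.

(** * Weighted graphs *)

(* The unordered pair {u, v} is represented by its increasing enumeration. *)
Definition upair (n : nat) := {p : 'I_n * 'I_n | (p.1 < p.2)%N}.

Definition wvec (R : Type) (n : nat) := upair n -> R.

Section Graphs.
Variables (R : realType) (n : nat).
Implicit Types (w : wvec R n) (u v : 'I_n).

(* The coordinate of w at {u, v}, and 0 if u = v. *)
Definition edge_coord w u v : R :=
  match insub (u, v) : option (upair n), insub (v, u) : option (upair n) with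
  | Some e, _ => w e
  | None, Some e => w e
  | None, None => 0
  end.

Definition nonneg_wvec w := forall e, 0 <= w e.

Definition norm0 w : nat := #|[pred e | w e != 0]|.
Definition norm1 w : R := \sum_(e : upair n) `|w e|.
Definition norm_infty_le1 w := forall e, `|w e| <= 1.

Definition neighboring w w' :=
  (norm0 (fun e => w e - w' e : R)%R <= 1)%N /\ norm_infty_le1 (fun e => w e - w' e).

(* E is the support of w. *)
Definition adj w : rel 'I_n := fun u v => edge_coord w u v != 0.

Definition connected_graph w := forall u v, connect (adj w) u v.

Definition max_degree w : nat := (\max_(u < n) #|[pred v | adj w u v]|)%N.

Definition wdegree w u : R := \sum_(v < n) edge_coord w u v.

Definition laplacian w : 'M[R]_n :=
  diag_mx (\row_u wdegree w u) - \matrix_(u, v) edge_coord w u v.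

(* The infimum is over a finite set, nonempty as soon as w is not zero. *)
Definition lambda w : R :=
  inf [set x | eigenvalue (laplacian w) x /\ x != 0].

Definition walk_step w u v : R := edge_coord w u v / wdegree w u.

(* Pr[min {s >= 1 : X_s = v} = t | X_1 = u]: the tuple x lists X_1, ..., X_t,
   and [index v x] is the 0-based position of the first v in x. *)
Definition hit_prob w u v (t : nat) : R :=
  \sum_(x : t.-tuple 'I_n | (ohead x == Some u) && (index v x == t.-1))
     \prod_(e <- zip x (behead x)) walk_step w e.1 e.2.

(* Expectation of the hitting time, which is +oo on the event that v is never
   hit (recall that +oo * 0 = 0). *)
Definition hitting_time w u v : \bar R :=
  (\sum_(0 <= t <oo) (t%:R * hit_prob w u v t)%:E
   + +oo * (1 - \sum_(0 <= t <oo) (hit_prob w u v t)%:E))%E.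

Definition commute_time w u v : \bar R :=
  (hitting_time w u v + hitting_time w v u)%E.

(* The product sigma-algebra. *)
Definition measurable_wvec : set (set (wvec R n)) :=
  <<s \bigcup_(e : upair n)
        preimage_set_system setT (fun x : wvec R n => x e) measurable >>.

End Graphs.

(** * Mechanisms and differential privacy *)

Section Privacy.
Variables (R : realType) (n : nat) (d : measure_display).
Variables (T : measurableType d) (P : probability T R).

(* A randomized map is given by a function of its input and of a random
   outcome in T; Pr[M w \in S] is the probability of the preimage of S. *)
Definition measurable_mechanism (M : wvec R n -> T -> wvec R n) :=
  forall w, nonneg_wvec w -> forall S, measurable_wvec S ->
  measurable (M w @^-1` S).

Definition differentially_private (eps delta : R)
    (M : wvec R n -> T -> wvec R n) :=
  forall w w', nonneg_wvec w -> nonneg_wvec w' -> neighboring w w' ->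
  forall S, measurable_wvec S ->
  (P (M w @^-1` S) <= (expR eps)%:E * P (M w' @^-1` S) + delta%:E)%E.

End Privacy.

(** * Randomized real RAM *)

(* The machine has natural-number registers, used for control and addressing,
   and unboundedly many two-dimensional arrays of real cells.  Its unit-cost
   operations are the field operations, ln and the order on reals, addition and
   truncated subtraction on naturals (no multiplication, so that registers keep
   polynomially many bits), and drawing a uniform variate in [0, 1].  Programs
   contain no real constants. *)
Inductive iexp : Type :=
| IReg of nat
| ICst of nat
| IAdd of iexp & iexp
| ISub of iexp & iexp.

Inductive rexp : Type :=
| RCell of nat & iexp & iexp
| RInt of iexp
| RAdd of rexp & rexp
| RSub of rexp & rexp
| RMul of rexp & rexp
| RDiv of rexp & rexp
| RLn of rexp.

Inductive test : Type :=
| ILt of iexp & iexp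
| RLt of rexp & rexp.

Inductive cmd : Type :=
| Skip
| Seq of cmd & cmd
| ISet of nat & iexp
| RSet of nat & iexp & iexp & rexp
| Draw of nat & iexp & iexp
| If of test & cmd & cmd
| While of test & cmd.

Section Machine.
Variable R : realType.

Record state := State {
  ireg : nat -> nat;
  cell : nat -> nat -> nat -> R;
  drawn : nat   (* number of variates drawn so far *)
}.

Fixpoint ieval (s : state) (e : iexp) : nat :=
  match e with
  | IReg x => ireg s x
  | ICst k => k
  | IAdd e1 e2 => (ieval s e1 + ieval s e2)%N
  | ISub e1 e2 => (ieval s e1 - ieval s e2)%N
  end.

Fixpoint reval (s : state) (e : rexp) : R :=
  match e with
  | RCell a i j => cell s a (ieval s i) (ieval s j)
  | RInt i => (ieval s i)%:R
  | RAdd e1 e2 => reval s e1 + reval s e2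
  | RSub e1 e2 => reval s e1 - reval s e2
  | RMul e1 e2 => reval s e1 * reval s e2
  | RDiv e1 e2 => reval s e1 / reval s e2
  | RLn e1 => ln (reval s e1)
  end.

Definition teval (s : state) (b : test) : bool :=
  match b with
  | ILt e1 e2 => (ieval s e1 < ieval s e2)%N
  | RLt e1 e2 => reval s e1 < reval s e2
  end.

Definition set_ireg (s : state) (x k : nat) : state :=
  State (fun y => if y == x then k else ireg s y) (cell s) (drawn s).

Definition set_cell (s : state) (a i j : nat) (r : R) : state :=
  State (ireg s)
    (fun a' i' j' => if [&& a' == a, i' == i & j' == j] then r
                     else cell s a' i' j')
    (drawn s).

Definition next_draw (s : state) : state :=
  State (ireg s) (cell s) (drawn s).+1.

(* A configuration is a stack of commands still to be executed and a state.
   Expressions belong to the fixed program text, so that charging one step per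
   command is correct up to a constant factor. *)
Definition step (tape : seq R) (k : seq cmd * state) : seq cmd * state :=
  let s := k.2 in
  match k.1 with
  | [::] => ([::], s)
  | Skip :: q => (q, s)
  | Seq c1 c2 :: q => (c1 :: c2 :: q, s)
  | ISet x e :: q => (q, set_ireg s x (ieval s e))
  | RSet a i j e :: q =>
      (q, set_cell s a (ieval s i) (ieval s j) (reval s e))
  | Draw a i j :: q =>
      (q, next_draw
            (set_cell s a (ieval s i) (ieval s j) (nth 0 tape (drawn s))))
  | If b c1 c2 :: q => ((if teval s b then c1 else c2) :: q, s)
  | While b c :: q => (if teval s b then c :: While b c :: q else q, s)
  end.

(* Input convention: n is in register 0, the symmetric weight matrix in array 0
   and eps in cell (0, 0) of array 1. *)
Definition init_state (n : nat) (eps : R) (w : wvec R n) : state :=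
  State
    (fun x => if x == 0%N then n else 0%N)
    (fun a i j =>
       if a == 0%N then
         match insub i : option 'I_n, insub j : option 'I_n with
         | Some u, Some v => edge_coord w u v
         | _, _ => 0
         end
       else if [&& a == 1%N, i == 0%N & j == 0%N] then eps else 0)
    0.

Definition run (A : cmd) (T n : nat) (eps : R) (w : wvec R n)
    (tape : seq R) : seq cmd * state :=
  iter T (step tape) ([:: A], init_state eps w).

(* Output convention: coordinate {u, v}, u < v, is in cell (u, v) of array 2.
   At most one variate is drawn per step, so T of them suffice for T steps. *)
Definition output (A : cmd) (T n : nat) (eps : R) (w : wvec R n)
    (tape : T.-tuple R) : wvec R n :=
  fun e => cell (run A T eps w tape).2 2 (val e).1 (val e).2.

Definition runs_in_time (A : cmd) (T n : nat) (eps : R) :=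
  forall w : wvec R n, nonneg_wvec w ->
  forall tape : T.-tuple R, (run A T eps w tape).1 = [::].

End Machine.

(** * The law of the tape: m independent uniform variates in [0, 1] *)

Section Tape.
Variable R : realType.

Definition uniform01 : probability (measurableTypeR R) R :=
  uniform_prob (@ltr01 R).

Section Cons.
Variable m : nat.

Definition tape_cons (x : measurableTypeR R * m.-tuple (measurableTypeR R)) :
  m.+1.-tuple (measurableTypeR R) := [tuple of x.1 :: x.2].

Let measurable_tape_cons : measurable_fun setT tape_cons.
Proof. by apply: measurable_cons. Qed.

HB.instance Definition _ :=
  isMeasurableFun.Build _ _ _ _ tape_cons measurable_tape_cons.

End Cons.

Fixpoint tape_law (m : nat) :
    probability (m.-tuple (measurableTypeR R)) R :=
  match m with
  | 0%N => \d_([tuple] : 0.-tuple (measurableTypeR R))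
  | m'.+1 =>
      distribution (uniform01 \x tape_law m')%E
        [the {mfun _ >-> _} of @tape_cons m']
  end.

End Tape.

(* Main.v *)
Require Import Defs.
From HB Require Import structures.
From mathcomp Require Import all_boot all_order all_algebra.
From mathcomp Require Import all_classical all_reals all_analysis.
From mathcomp Require Import measurable_realfun ring lra zify.

Set Implicit Arguments.
Unset Strict Implicit.
Unset Printing Implicit Defensive.

Import Order.TTheory GRing.Theory Num.Theory.
Import numFieldNormedType.Exports.

Local Open Scope classical_set_scope.
Local Open Scope ring_scope.

(** The algorithm adds logistic noise of scale [1 / eps] to every coordinate.
    The logistic density changes by a factor at most [exp eps] under a unit
      shift,
    so the noisy vector is [eps]-private and the rest is post-processing.  With
    high probability every noise is at most [T = (a + 3) ln n / eps].  Weights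
    below [T] are then dropped and [T] is added to the others;
      when [n] is below a
    constant [n0], nothing is dropped.  Either way the Laplacian moves by
    [O(T * Delta)] and remains at least [lambda / 2] on the vectors of sum zero:
    for large [n] by the hypothesis on [lambda], for small [n] because weights
    only increase.

    The commute time is [2 + 2 |w|_1 R_uv], where [R_uv] is the effective
    resistance (the walk is at [X_1 = u] at time 1, whence the summand 2), and
    [R_uv] is read off the inverse of [L + J], with [J] the all-ones matrix.
      The
    program computes this inverse by starting from the complete graph, where
    [L + J = n I], and correcting one edge at a time by the Sherman-Morrison
    formula.  Two effective resistances differ by [y' (L - L') y], where the
    potentials [y] and [y'] have norm [O(1 / lambda)]. *)

(** * Total correctness with step counts *)

(** Dropping small weights is what puts [Delta] in the bound: noise on all pairs would move each
    degree by up to [n * T], while a pair of weight 0 never passes the threshold when its noise is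
    at most [T]. Dropping could disconnect a small graph, hence the constant [n0]. The hypothesis
    gives [lambda > 2 Delta ln^2 n / eps], while the perturbation is of order
    [Delta * (a + 3) * ln n / eps]; the spare logarithm absorbs the constant as soon as
    [ln n >= 4 (a + 3)].

    Logistic noise is the logarithm of the odds of a uniform variate, so it takes one division and
    one [ln]. A shift of the noise by [ln t / eps] multiplies the odds by [t]; privacy thus reduces
    to how much this explicit map of the unit interval can distort Lebesgue measure, with no density
    on the output space.

    The program never tests a real: the threshold is an arithmetic expression. Control flow is then
    the same for all tapes, which gives measurability and the time bound without case analysis on
    the noise.

    Hitting times are not computed from their series; a solution of the first-step equations is
    exhibited and any such solution is shown to be the expectation. *)

Definition For (x : nat) (e : iexp) (c : cmd) : cmd :=
  Seq (ISet x (ICst 0))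
      (While (ILt (IReg x) e) (Seq c (ISet x (IAdd (IReg x) (ICst 1))))).

Section Triples.
Variables (R : realType) (tape : seq R).
Implicit Types (P Q S : state R -> Prop) (c : cmd) (s : state R).

(** The pending stack [q] is arbitrary, so that triples compose under [Seq] and [While]; the
    existence of [k] makes them total. *)
Definition triple P c (t : nat) Q := forall s q, P s ->
  exists2 k, (k <= t)%N &
  exists2 s', iter k (step tape) (c :: q, s) = (q, s') & Q s'.

Lemma triple_conseq P Q P' Q' c t : triple P' c t Q' ->
  (forall s, P s -> P' s) -> (forall s, Q' s -> Q s) -> triple P c t Q.
Proof.
move=> H PP QQ s q /PP/(H s q)[k kt [s' Es /QQ Qs]].
by exists k => //; exists s'.
Qed.

Lemma triple_weaken P Q c t t' : triple P c t Q -> (t <= t')%N ->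
  triple P c t' Q.
Proof.
by move=> H tt' s q /(H s q)[k kt ?]; exists k => //; exact: leq_trans tt'.
Qed.

Lemma triple_seq P Q S c1 c2 t1 t2 :
  triple P c1 t1 Q -> triple Q c2 t2 S -> triple P (Seq c1 c2) (t1 + t2).+1 S.
Proof.
move=> H1 H2 s q Ps.
have [k1 k1t [s1 E1 Q1]] := H1 s (c2 :: q) Ps.
have [k2 k2t [s2 E2 Q2]] := H2 s1 q Q1.
exists (k2 + k1.+1)%N; first by rewrite addnS ltnS addnC leq_add.
by exists s2 => //; rewrite iterD iterSr /= E1.
Qed.

Lemma triple_rset Q a i j e :
  triple (fun s => Q (set_cell s a (ieval s i) (ieval s j) (reval s e)))
    (RSet a i j e) 1 Q.
Proof. by move=> s q Qs; exists 1%N => //; eexists; [reflexivity|]. Qed.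

Lemma triple_draw Q a i j :
  triple (fun s => Q (next_draw
      (set_cell s a (ieval s i) (ieval s j) (nth 0 tape (drawn s)))))
    (Draw a i j) 1 Q.
Proof. by move=> s q Qs; exists 1%N => //; eexists; [reflexivity|]. Qed.

(** Each iteration pays 3 steps besides the body (test, [Seq], increment); the other 3 are the outer
    [Seq], the initialisation and the last, failing test. *)
Lemma triple_for (I : nat -> state R -> Prop) (m t x : nat) (e : iexp) c :
  (forall k s l, I k s -> I k (set_ireg s x l)) ->
  (forall k s, I k s -> ieval s e = m) ->
  (forall k, (k < m)%N -> triple (fun s => I k s /\ ireg s x = k) c t
                            (fun s => I k.+1 s /\ ireg s x = k)) ->
  triple (I 0%N) (For x e c) (m * (t + 3) + 3) (I m).
Proof.
move=> Ix Ie Hc s q I0.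
rewrite /For; set body := Seq c _; set b := ILt _ _.
suff H k : (k <= m)%N -> exists2 l, (l <= k * (t + 3))%N &
    exists2 s', iter l (step tape) (While b body :: q, set_ireg s x 0) =
      (While b body :: q, s') & I k s' /\ ireg s' x = k.
  have [l lk [s' Es' [Is' xs']]] := H m (leqnn m).
  exists (1 + (l + 2))%N; first by rewrite addnC -addnA leq_add2r.
  exists s' => //; rewrite iterD iterD /= Es'.
  by rewrite /step /= (Ie m) // xs' ltnn.
elim: k => [_|k IH km].
  by exists 0%N => //; exists (set_ireg s x 0); [|split;
    [exact: Ix|rewrite /= eqxx]].
have [l lk [s' Es' [Is' xs']]] := IH (ltnW km).
have [k' k't [s'' Es'' [Is'' xs'']]] :=
  Hc k km s' (ISet x (IAdd (IReg x) (ICst 1)) :: While b body :: q) (conj Is'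
    xs').
exists (1 + (k' + (2 + l)))%N; first by rewrite mulSn; lia.
exists (set_ireg s'' x k.+1); last by split; [exact: Ix|rewrite /= eqxx].
rewrite iterD iterD iterD Es'.
rewrite [iter 2 _ _](_ : _ = (c :: ISet x (IAdd (IReg x) (ICst 1)) ::
                              While b body :: q, s')) ?Es'' /=.
  by rewrite /step /= xs'' addn1.
by rewrite /= /step /= (Ie k) // xs' km.
Qed.

End Triples.

(** Row-major indices serve twice: they measure progress of the double loops and give the tape
    position of the variate of an edge. *)
Lemma pair_index_inj (m a b a' b' : nat) : (b < m)%N -> (b' < m)%N ->
  (a * m + b = a' * m + b')%N -> a = a' /\ b = b'.
Proof.
move=> bm b'm E.
have := congr1 (divn^~ m) E; have := congr1 (modn^~ m) E.
rewrite /= !modnMDl !divnMDl ?(leq_ltn_trans _ bm) // !divn_small //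
  !modn_small //.
by rewrite !addn0.
Qed.

Lemma pair_index_lt (m a b : nat) : (a < m)%N -> (b < m)%N -> (a * m + b < m *
  m)%N.
Proof.
move=> am bm; rewrite (leq_trans (n := a * m + m)) ?ltn_add2l //.
by rewrite addnC -mulSn leq_mul2r am orbT.
Qed.

(** * The program *)

Section Program.
Variables tau n0 : nat.

(* Arrays: 3 holds the variates, 4 the current inverse, 6 the difference of two
   of its columns; 5 is scratch space and 7 accumulates the sum of the degrees.
     *)
Let n := IReg 0.
Let u := IReg 1.
Let v := IReg 2.
Let i := IReg 3.
Let j := IReg 4.
Let zero := ICst 0.
Let one := ICst 1.
Let rone := RInt one.
Let eps := RCell 1 zero zero.
Let B := RCell 4.

Let draws := For 1 n (For 2 n (Draw 3 u v)).

Let inverse_init := For 3 n (RSet 4 i i (RDiv rone (RInt n))).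

Let noisy := RAdd (RCell 0 u v)
  (RDiv (RLn (RDiv (RCell 3 u v) (RSub rone (RCell 3 u v)))) eps).

Let h := RCell 5 zero zero.
Let thr := RMul (RInt (ICst tau)) (RDiv (RLn (RInt n)) eps).
Let z := RInt (ISub (ICst n0) n).
Let y := RSub h thr.
(** Division by zero returns 0, so this is the indicator of [e = 0], obtained without a test on
    reals. *)
Let defect e := RSub rone (RDiv e e).
Let keep := RSub rone
  (RMul (RMul (defect z) (defect (RLn y))) (defect (RLn (RAdd y y)))).
Let x := RCell 5 zero one.
Let gain := RDiv (RSub x rone) (RAdd rone (RMul (RSub x rone)
  (RSub (RSub (RAdd (B u u) (B v v)) (B u v)) (B v u)))).

(** The column difference is saved in array 6 and the gain in array 5 because the rank-one
    correction then overwrites array 4 in place. The weight is added twice to array 7 since it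
    counts in two degrees. *)
Let edge :=
  Seq (RSet 5 zero zero noisy)
 (Seq (RSet 5 zero one (RMul (RAdd h thr) keep))
 (Seq (RSet 5 one zero gain)
 (Seq (For 3 n (RSet 6 i zero (RSub (B i u) (B i v))))
 (Seq (For 3 n (For 4 n (RSet 4 i j
        (RSub (B i j) (RMul (RMul (RCell 5 one zero) (RCell 6 i zero))
                            (RCell 6 j zero))))))
      (RSet 7 zero zero (RAdd (RCell 7 zero zero) (RAdd x x))))))).

Let result := For 3 n (For 4 n (RSet 2 i j
  (RAdd (RInt (ICst 2)) (RMul (RCell 7 zero zero)
     (RSub (RSub (RAdd (B i i) (B j j)) (B i j)) (B j i)))))).

Definition program : cmd :=
  Seq draws (Seq inverse_init (Seq (For 1 n (For 2 u edge)) result)).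

Variables (R : realType).
Implicit Types (f wt : nat -> nat -> R).

Definition logit (p : R) : R := ln (p / (1 - p)).

Definition threshold (n : nat) (e : R) : R := tau%:R * (ln n%:R / e).

(* [keep_ind n y] is the indicator of [n < n0 \/ 0 < y]: since [ln] vanishes on
   nonpositive reals, [ln y / ln y] is the indicator of [0 < y != 1]. *)
Definition keep_ind (n : nat) (y : R) : R :=
  1 - (1 - (n0 - n)%:R / (n0 - n)%:R) * (1 - ln y / ln y)
      * (1 - ln (y + y) / ln (y + y)).

Definition sanitize (n : nat) (e h : R) : R :=
  (h + threshold n e) * keep_ind n (h - threshold n e).

(** The Sherman-Morrison formula for changing the weight of the edge between [u] and [v] from 1 to
    [x], where [f] is the current, symmetric inverse. *)
Definition edge_update (x : R) (u v : nat) f : nat -> nat -> R := fun i j =>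
  f i j - (x - 1) / (1 + (x - 1) * (f u u + f v v - f u v - f v u))
          * (f i u - f i v) * (f j u - f j v).

Fixpoint row_update wt (u k : nat) f : nat -> nat -> R :=
  if k is l.+1 then edge_update (wt u l) u l (row_update wt u l f) else f.

Fixpoint inverse_upto wt (n k : nat) : nat -> nat -> R :=
  if k is l.+1 then row_update wt l l (inverse_upto wt n l)
  else fun i j => if i == j then 1 / n%:R else 0.

Definition row_total wt (u k : nat) : R := \sum_(0 <= v < k) (wt u v + wt u v).
Definition total_upto wt (k : nat) : R := \sum_(0 <= u < k) row_total wt u u.

Definition estimate wt (n i j : nat) : R :=
  2 + total_upto wt n *
    (inverse_upto wt n n i i + inverse_upto wt n n j j
     - inverse_upto wt n n i j - inverse_upto wt n n j i).

(** The nesting copies the bounds produced by [triple_seq] and [triple_for], so that they unify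
    without arithmetic. *)
Definition edge_time (m : nat) : nat :=
  (1 + (1 + (1 + (m * 4 + 3 + (m * (m * 4 + 3 + 3) + 3 +
    1).+1).+1).+1).+1).+1%N.

Definition time_bound (m : nat) : nat :=
  (m * (m * 4 + 3 + 3) + 3 + (m * 4 + 3
    + (m * (m * (edge_time m + 3) + 3 + 3) + 3
       + (m * (m * 4 + 3 + 3) + 3)).+1).+1).+1%N.

Section Run.
Variables (m : nat) (e : R) (W : nat -> nat -> R) (tape : seq R).

Let X a b : R := nth 0 tape (a * m + b).
Let wt a b := sanitize m e (W a b + logit (X a b) / e).

Let base (s : state R) := [/\ ireg s 0 = m,
  forall a b, (a < m)%N -> (b < m)%N -> cell s 0 a b = W a b &
  cell s 1 0 0 = e].

Let start (s : state R) := [/\ base s, drawn s = 0%N &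
  forall k a b, (2 <= k)%N -> cell s k a b = 0].

(** Arrays 4 and above must stay blank: the off-diagonal zeros of the initial inverse and the
    initial accumulator are never written. *)
Let drawnp (r k : nat) (s : state R) := [/\ base s, drawn s = (r * m + k)%N,
  (forall a b, (a < m)%N -> (b < m)%N -> (a * m + b < r * m + k)%N ->
     cell s 3 a b = X a b) & forall l a b, (4 <= l)%N -> cell s l a b = 0].

Let draws_ok : triple tape start draws (m * (m * 4 + 3 + 3) + 3) (drawnp m 0).
Proof.
apply: (@triple_conseq _ _ _ _ (drawnp 0 0) (drawnp m 0)) => //; last first.
  by move=> s [bs ds cs]; split => // l a b l4; rewrite cs // (leq_trans _ l4).
apply: (@triple_for _ _ (fun r => drawnp r 0)).
- by move=> k s l.
- by move=> k s [[]].
- move=> r rm.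
  pose J k (s : state R) := drawnp r k s /\ ireg s 1 = r.
  apply: (@triple_conseq _ _ _ _ (J 0%N) (J m)) => //; last first.
  + by move=> s [[bs ds cs c4] ->]; rewrite /drawnp addn0 mulSn [(m +
    _)%N]addnC.
  apply: (@triple_for _ _ J m 1).
  + by move=> k s l.
  + by move=> k s [[[]]].
  move=> k km; apply: triple_conseq; first exact: triple_draw;
    last by move=> s; exact.
  move=> s [[[[s0 s1 s2] ds cs c4] r1] k2]; split=> //; split=> //.
  split=> //=.
  - by rewrite ds addnS.
  - move=> a b am bm; rewrite r1 k2 addnS ltnS => ab.
    case: ifPn => [/andP[/eqP-> /eqP->]|ne]; first by rewrite ds.
    apply: cs => //; rewrite ltn_neqAle ab andbT.
    apply: contra ne => /eqP abE.
    by have [-> ->] := pair_index_inj bm km abE; rewrite !eqxx.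
  - by move=> l a b l4; case: l l4 => [|[|[|[|l]]]] //= l4; exact: c4.
Qed.

Let base3 (s : state R) := base s /\
  forall a b, (a < m)%N -> (b < m)%N -> cell s 3 a b = X a b.

Let inited (k : nat) (s : state R) := [/\ base3 s, cell s 7 0 0 = 0 &
  forall a b, cell s 4 a b = if (a == b) && (a < k)%N then 1 / m%:R else 0].

Let init_ok : triple tape (drawnp m 0) inverse_init (m * 4 + 3) (inited m).
Proof.
apply: (@triple_conseq _ _ _ _ (inited 0) (inited m)) => //; last first.
  move=> s [bs ds cs c4]; split; [|exact: c4|by move=> a b;
    rewrite ltn0 andbF c4].
  by split=> // a b am bm; apply: cs => //; rewrite addn0 pair_index_lt.
apply: (@triple_for _ _ inited m 1).
- by move=> k s l.
- by move=> k s [[[]]].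
- move=> k km; apply: triple_conseq; first exact: triple_rset;
  last by move=> s; exact.
  move=> s [[[[s0 s1 s2] c3] c7 c4] i3]; split=> //; split=> //= a b.
  rewrite i3 s0 ltnS c4 [(a <= k)%N]leq_eqVlt; case: (eqVneq a k) => [->|ak] /=.
    by rewrite ltnn andbF andbT [k == b]eq_sym; case: eqP.
  by [].
Qed.

Let looping (r k : nat) (s : state R) := [/\ base3 s,
  (forall a b, (a < m)%N -> (b < m)%N ->
     cell s 4 a b = row_update wt r k (inverse_upto wt m r) a b)
  & cell s 7 0 0 = total_upto wt r + row_total wt r k].

Section Edge.
Variables (r k : nat) (rm : (r < m)%N) (kr : (k < r)%N).
Let km : (k < m)%N := ltn_trans kr rm.
Let F := row_update wt r k (inverse_upto wt m r).
Let F' := edge_update (wt r k) r k F.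
Let g := (wt r k - 1) / (1 + (wt r k - 1) * (F r r + F k k - F r k - F k r)).

Let common (s : state R) := [/\ base3 s, ireg s 1 = r, ireg s 2 = k &
  cell s 7 0 0 = total_upto wt r + row_total wt r k].

Let arr4 f (s : state R) :=
  forall a b, (a < m)%N -> (b < m)%N -> cell s 4 a b = f a b.

Let stage1 s := [/\ common s, arr4 F s &
  cell s 5 0 0 = W r k + logit (X r k) / e].
Let stage2 s := [/\ common s, arr4 F s & cell s 5 0 1 = wt r k].
Let stage3 s := stage2 s /\ cell s 5 1 0 = g.
Let stage4 l s := stage3 s /\
  forall a, (a < l)%N -> cell s 6 a 0 = F a r - F a k.
(** In-place update: entries before [(p, q)] in row-major order are new. The loop body reads array 4
    only at the entry that it overwrites, so the mixture is harmless. *)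
Let stage5 p q (s : state R) := [/\ common s, cell s 5 0 1 = wt r k,
  cell s 5 1 0 = g,
  forall a, (a < m)%N -> cell s 6 a 0 = F a r - F a k &
  arr4 (fun a b => if (a * m + b < p * m + q)%N then F' a b else F a b) s].

Let edge1 : triple tape (fun s => (looping r k s /\ ireg s 1 = r) /\ ireg s 2 =
  k)
  (RSet 5 zero zero noisy) 1 stage1.
Proof.
apply: triple_conseq; first exact: triple_rset; last by move=> s; exact.
move=> s [[[[[s0 s1 s2] c3] c4 c7] r1] r2]; split=> //=.
by rewrite r1 r2 s1 // c3 // s2.
Qed.

Let edge2 : triple tape stage1 (RSet 5 zero one (RMul (RAdd h thr) keep)) 1
  stage2.
Proof.
apply: triple_conseq; first exact: triple_rset; last by move=> s; exact.
by move=> s [[[[s0 s1 s2] c3] r1 r2 c7] c4 c5]; split=> //=; rewrite s0 s2 c5.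
Qed.

Let edge3 : triple tape stage2 (RSet 5 one zero gain) 1 stage3.
Proof.
apply: triple_conseq; first exact: triple_rset; last by move=> s; exact.
move=> s [[[[s0 s1 s2] c3] r1 r2 c7] c4 c5]; split=> //=.
by rewrite c5 r1 r2 !c4.
Qed.

Let edge4 : triple tape stage3 (For 3 n (RSet 6 i zero (RSub (B i u) (B i v))))
  (m * 4 + 3) (stage5 0 0).
Proof.
apply: (@triple_conseq _ _ _ _ (stage4 0) (stage4 m)); last 2 first.
- by [].
- by move=> s [[[[b3 r1 r2 c7] c4 c5] c51] c6]; split=> // a b am bm; exact: c4.
apply: (@triple_for _ _ stage4 m 1).
- by move=> l s l'.
- by move=> l s [[[[[[]]]]]].
- move=> l lm; apply: triple_conseq; first exact: triple_rset;
  last by move=> s; exact.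
  move=> s [[[[[[[s0 s1 s2] c3] r1 r2 c7] c4 c5] c51] c6] i3].
  split=> //; split=> //= a; rewrite i3 andbT ltnS leq_eqVlt.
  by case: eqP => [->|] /= _; rewrite ?r1 ?r2 ?c4 //; exact: c6.
Qed.

Let edge5 : triple tape (stage5 0 0) (For 3 n (For 4 n (RSet 4 i j
        (RSub (B i j) (RMul (RMul (RCell 5 one zero) (RCell 6 i zero))
                            (RCell 6 j zero))))))
  (m * (m * 4 + 3 + 3) + 3) (stage5 m 0).
Proof.
apply: (@triple_for _ _ (fun p => stage5 p 0)).
- by move=> p s l.
- by move=> p s [[[[]]]].
move=> p pm.
pose J q s := stage5 p q s /\ ireg s 3 = p.
apply: (@triple_conseq _ _ _ _ (J 0%N) (J m)) => //; last first.
  by move=> s [[? ? ? ? c4] ->]; rewrite /stage5 addn0 mulSn [(m + _)%N]addnC.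
apply: (@triple_for _ _ J m 1).
- by move=> q s l.
- by move=> q s [[[[[]]]]].
move=> q qm; apply: triple_conseq; first exact: triple_rset; last by move=> s;
  exact.
move=> s [[[[[[s0 s1 s2] c3] r1 r2 c7] c5 c51 c6 c4] i3] j4].
split=> //; split=> //; split=> //= a b am bm.
rewrite i3 j4; have [/andP[/eqP-> /eqP->]|ne] := boolP ((a == p) && (b == q)).
  rewrite addnS ltnS leqnn c4 // ltnn c51 !c6 //.
  by rewrite /set_cell /= !eqxx.
rewrite /set_cell /= (negbTE ne) c4 // addnS ltnS [in RHS]leq_eqVlt;
  case: eqP => //= abE.
by have [aE bE] := pair_index_inj bm qm abE; rewrite aE bE !eqxx in ne.
Qed.

Let edge6 : triple tape (stage5 m 0)
  (RSet 7 zero zero (RAdd (RCell 7 zero zero) (RAdd x x))) 1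
  (fun s => (looping r k.+1 s /\ ireg s 1 = r) /\ ireg s 2 = k).
Proof.
apply: triple_conseq; first exact: triple_rset; last by move=> s; exact.
move=> s [[[[s0 s1 s2] c3] r1 r2 c7] c5 c51 c6 c4].
split=> //; split=> //; split=> //= [a b am bm|].
  by rewrite c4 // addn0 pair_index_lt.
by rewrite c7 c5 -addrA; congr (_ + _); rewrite [RHS]big_nat_recr.
Qed.

Lemma edge_ok : triple tape
  (fun s => (looping r k s /\ ireg s 1 = r) /\ ireg s 2 = k) edge
  (edge_time m)
  (fun s => (looping r k.+1 s /\ ireg s 1 = r) /\ ireg s 2 = k).
Proof.
apply: triple_seq edge1 _; apply: triple_seq edge2 _.
apply: triple_seq edge3 _; apply: triple_seq edge4 _.
exact: triple_seq edge5 edge6.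
Qed.

End Edge.

Let loops_ok : triple tape (inited m) (For 1 n (For 2 u edge))
  (m * (m * (edge_time m + 3) + 3 + 3) + 3) (looping m 0).
Proof.
apply: (@triple_conseq _ _ _ _ (looping 0 0) (looping m 0)) => //; last first.
  move=> s [b3 c7 c4]; split; [by []|by move=> a b am bm; rewrite c4 am andbT|].
  by rewrite c7 /total_upto /row_total !big_geq // addr0.
apply: (@triple_for _ _ (fun r => looping r 0)).
- by move=> r s l.
- by move=> r s [[[]]].
move=> r rm.
pose J k s := looping r k s /\ ireg s 1 = r.
apply: (@triple_weaken _ _ _ _ _ (r * (edge_time m + 3) + 3)); last first.
  by rewrite leq_add2r leq_mul2r (ltnW rm) orbT.
apply: (@triple_conseq _ _ _ _ (J 0%N) (J r)) => //; last first.
  move=> s [[b3 c4 c7] ->]; split=> //; split=> //.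
  rewrite c7 /total_upto big_nat_recr //= /row_total [X in _ = _ + X]big_geq //.
  by rewrite addr0.
apply: (@triple_for _ _ J r (edge_time m)).
- by move=> k s l.
- by move=> k s [_ <-].
by move=> k kr; exact: edge_ok.
Qed.

Let final (p q : nat) (s : state R) := looping m 0 s /\
  forall a b, (a < m)%N -> (b < m)%N -> (a * m + b < p * m + q)%N ->
    cell s 2 a b = estimate wt m a b.

Let result_ok : triple tape (looping m 0) result (m * (m * 4 + 3 + 3) + 3)
  (final m 0).
Proof.
apply: (@triple_conseq _ _ _ _ (final 0 0) (final m 0)) => //; first last.
apply: (@triple_for _ _ (fun p => final p 0)).
- by move=> p s l.
- by move=> p s [[[[]]]].
move=> p pm.
pose J q s := final p q s /\ ireg s 3 = p.
apply: (@triple_conseq _ _ _ _ (J 0%N) (J m)) => //; last first.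
  by move=> s [[? c2] ->]; rewrite /final addn0 mulSn [(m + _)%N]addnC.
apply: (@triple_for _ _ J m 1).
- by move=> q s l.
- by move=> q s [[[[[]]]]].
move=> q qm; apply: triple_conseq; first exact: triple_rset; last by move=> s;
  exact.
move=> s [[[[[[s0 s1 s2] c3] c4 c7] c2] i3] j4].
split=> //; split=> //; split=> //= a b am bm.
rewrite i3 j4; have [/andP[/eqP-> /eqP->] _|ne] := boolP ((a == p) && (b == q)).
  by rewrite c7 !c4 // /row_total big_geq // addr0.
rewrite addnS ltnS leq_eqVlt => /orP[/eqP abE|]; last exact: c2.
by have [aE bE] := pair_index_inj bm qm abE; rewrite aE bE !eqxx in ne.
Qed.

Lemma program_ok : triple tape start program (time_bound m)
  (fun s => forall a b, (a < m)%N -> (b < m)%N -> cell s 2 a b = estimate wt m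
    a b).
Proof.
apply: triple_seq draws_ok _; apply: triple_seq init_ok _.
apply: triple_seq loops_ok _; apply: triple_conseq result_ok _ _ => //.
by move=> s [_ c2] a b am bm; apply: c2 => //; rewrite addn0 pair_index_lt.
Qed.

End Run.
End Program.

Definition time_poly : {poly nat} :=
  let k (c : nat) : {poly nat} := c%:P in
  let sq := 'X * ('X * k 4 + k 6) + k 3 in
  let edge := 'X * k 4 + sq + k 12 in
  sq + sq + 'X * k 4 + 'X * ('X * (edge + k 3) + k 6) + k 9.

Lemma time_polyE (m : nat) : time_poly.[m] = time_bound m.
Proof.
rewrite /time_poly /time_bound /edge_time !(hornerD, hornerM, hornerX, hornerC).
rewrite !natrDE !natrME; lia.
Qed.

(** * Running the program from its initial state *)

Section RunProgram.
Variables (R : realType) (tau n0 : nat).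

Definition weight_at (n : nat) (w : wvec R n) (a b : nat) : R :=
  match insub a : option 'I_n, insub b : option 'I_n with
  | Some u, Some v => edge_coord w u v
  | _, _ => 0
  end.

Lemma weight_atE (n : nat) (w : wvec R n) (u v : 'I_n) :
  weight_at w u v = edge_coord w u v.
Proof. by rewrite /weight_at !valK. Qed.

Definition noisy_weight (n : nat) (eps : R) (w : wvec R n) (tape : seq R)
    (a b : nat) : R := weight_at w a b + logit tape`_(a * n + b) / eps.

Lemma run_program (n T : nat) (eps : R) (w : wvec R n) (tape : seq R) :
  (time_bound n <= T)%N ->
  let wt a b := sanitize tau n0 n eps (noisy_weight eps w tape a b) in
  (run (program tau n0) T eps w tape).1 = [::] /\
  forall a b, (a < n)%N -> (b < n)%N ->
    cell (run (program tau n0) T eps w tape).2 2 a b = estimate wt n a b.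
Proof.
move=> nT wt.
have [] := @program_ok tau n0 R n eps (weight_at w) tape (init_state eps w)
  [::].
  by split=> // [] [|[|k]].
move=> k kn [s' Es' Hs']; rewrite /run -(subnK (leq_trans kn nT)) iterD Es'.
by have -> : forall l, iter l (step tape) ([::], s') = ([::], s') by elim=> //
  l IHl; rewrite iterS IHl.
Qed.

(** Only the strict lower triangle is read; the variates on and above the diagonal never influence
    the output, so a coupling may ignore them. *)
Lemma estimate_ext (f g : nat -> nat -> R) n i j :
  (forall a b, (b < a)%N -> (a < n)%N -> f a b = g a b) ->
  estimate f n i j = estimate g n i j.
Proof.
move=> fg.
have tE : total_upto f n = total_upto g n.
  rewrite /total_upto !big_mkord; apply: eq_bigr => u _;
    rewrite /row_total !big_mkord.
  by apply: eq_bigr => v _; rewrite fg.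
have rE u k h : (k <= u)%N -> (u < n)%N -> row_update f u k h = row_update g u
  k h.
  by elim: k => //= k IH ku un; rewrite IH ?fg // ltnW.
have iE k : (k <= n)%N -> inverse_upto f n k = inverse_upto g n k.
  by elim: k => //= k IH kn; rewrite IH ?rE // ltnW.
by rewrite /estimate tE iE.
Qed.

End RunProgram.

(** * Measurability *)

(* Without tests on reals, the control flow does not depend on the tape. *)
Fixpoint oblivious (c : cmd) : bool :=
  match c with
  | Seq c1 c2 => oblivious c1 && oblivious c2
  | If b c1 c2 => [&& (if b is ILt _ _ then true else false), oblivious c1 &
    oblivious c2]
  | While b c1 => (if b is ILt _ _ then true else false) && oblivious c1
  | _ => true
  end.

Lemma program_oblivious tau n0 : oblivious (program tau n0).
Proof. by []. Qed.

Lemma measurable_invr (R : realType) :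
  measurable_fun [set: measurableTypeR R] (fun x : R => x^-1 : measurableTypeR
    R).
Proof.
rewrite (_ : [set: _] = [set 0] `|` [set~ 0]); last by rewrite setUv.
apply/measurable_funU => //; first exact: measurableC.
split; first exact: measurable_fun_set1.
apply: open_continuous_measurable_fun.
  exact/closed_openC/accessible_closed_set1/hausdorff_accessible/Rhausdorff.
by move=> x; rewrite inE /= => /eqP x0; exact: inv_continuous.
Qed.

Lemma measurable_nth_tuple (R : realType) (T k : nat) :
  measurable_fun [set: T.-tuple (measurableTypeR R)]
    (fun tape : T.-tuple R => nth 0 tape k : measurableTypeR R).
Proof.
have [kT|Tk] := ltnP k T.
  rewrite (_ : (fun _ => _) = (@tnth T (measurableTypeR R))^~ (Ordinal kT)).
    exact: measurable_tnth.
  by apply/funext => t; rewrite (tnth_nth 0).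
rewrite (_ : (fun _ => _) = cst 0) //.
by apply/funext => t; rewrite nth_default // size_tuple.
Qed.

Section Oblivious.
Variables (R : realType) (T : nat).

(** The invariant of execution without real tests: stack, registers and draw count are common to all
    tapes, and only the real cells vary, measurably. *)
Definition oblivious_conf (F : T.-tuple R -> seq cmd * state R) :=
  exists q r d (c : T.-tuple R -> nat -> nat -> nat -> R),
  [/\ forall tape, F tape = (q, State r (c tape) d), all oblivious q &
      forall a i j, measurable_fun [set: T.-tuple (measurableTypeR R)]
        (fun tape => c tape a i j : measurableTypeR R)].

Lemma measurable_reval (c : T.-tuple R -> nat -> nat -> nat -> R) r d (e :
  rexp) :
  (forall a i j, measurable_fun [set: T.-tuple (measurableTypeR R)]
        (fun tape => c tape a i j : measurableTypeR R)) ->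
  measurable_fun [set: T.-tuple (measurableTypeR R)]
    (fun tape => reval (State r (c tape) d) e : measurableTypeR R).
Proof.
have ie i tape : ieval (State r (c tape) d) i = ieval (State r (fun _ _ _ => 0
  : R) d) i.
  by elim: i => //= i -> j ->.
move=> mc; elim: e => /=.
- by move=> a i j; under eq_fun do rewrite !ie; exact: mc.
- by move=> i; under eq_fun do rewrite ie; exact: measurable_cst.
- by move=> e1 m1 e2 m2; exact: measurable_funD.
- by move=> e1 m1 e2 m2; exact: measurable_funB.
- by move=> e1 m1 e2 m2; exact: measurable_funM.
- move=> e1 m1 e2 m2; apply: measurable_funM => //.
  exact: (measurableT_comp (@measurable_invr R)).
- by move=> e1 m1; exact: (measurableT_comp (@measurable_ln R)).
Qed.

Lemma oblivious_step F : oblivious_conf F ->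
  oblivious_conf (fun tape => step tape (F tape)).
Proof.
move=> [q [r [d [c [FE oq mc]]]]].
pose z0 := State r (fun _ _ _ => 0 : R) d.
have ie i tape : ieval (State r (c tape) d) i = ieval z0 i.
  by elim: i => //= i -> j ->.
have set_m (g : T.-tuple R -> R) b i j :
    measurable_fun [set: T.-tuple (measurableTypeR R)] (g : _ ->
      measurableTypeR R) ->
    forall a' i' j', measurable_fun [set: T.-tuple (measurableTypeR R)]
      (fun tape => (if [&& a' == b, i' == i & j' == j] then g tape
                   else c tape a' i' j') : measurableTypeR R).
  by move=> mg a' i' j'; case: ([&& _, _ & _]).
case: q oq FE => [|k q] /=; first by move=> oq FE; exists [::], r, d, c;
  split=> // tape; rewrite FE.
case/andP=> ok oq FE; case: k ok FE => /=.
- by move=> _ FE; exists q, r, d, c; split=> // tape; rewrite FE.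
- move=> c1 c2 /andP[ ob1 ob2] FE; exists (c1 :: c2 :: q), r, d, c;
  split=> //= [tape|].
    by rewrite FE.
  by rewrite ob1 ob2.
- move=> x e _ FE; eexists q, _, d, c; split=> // tape;
  rewrite FE /step /= /set_ireg /= ie.
  reflexivity.
- move=> a i j e _ FE; exists q, r, d, (fun (tape : T.-tuple R) a' i' j' =>
    if [&& a' == a, i' == ieval z0 i & j' == ieval z0 j]
    then reval (State r (c tape) d) e else c tape a' i' j').
  split=> //; first by move=> tape; rewrite FE /step /= /set_cell /= !ie.
  apply: set_m; exact: (measurable_reval r d e mc).
- move=> a i j _ FE; exists q, r, d.+1, (fun (tape : T.-tuple R) a' i' j' =>
    if [&& a' == a, i' == ieval z0 i & j' == ieval z0 j]
    then nth 0 tape d else c tape a' i' j').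
  split=> //; first by move=> tape; rewrite FE /step /= /set_cell /next_draw /=
    !ie.
  apply: set_m; exact: (@measurable_nth_tuple R T d).
- move=> [e1 e2|//] c1 c2 /= /andP[ ob1 ob2] FE.
  exists ((if (ieval z0 e1 <
    ieval z0 e2)%N then c1 else c2) :: q), r, d, c.
  split=> //= [tape|]; first by rewrite FE /step /= !ie.
  by case: ifP; rewrite ?ob1 ?ob2.
- move=> [e1 e2|//] c1 /= ob1 FE.
  exists (if (ieval z0 e1 <
    ieval z0 e2)%N
    then c1 :: While (ILt e1 e2) c1 :: q else q), r, d, c.
  split=> //= [tape|]; first by rewrite FE /step /= !ie.
  by case: ifP; rewrite //= ob1.
Qed.

Lemma measurable_output_coord (A : cmd) (n : nat) (eps : R) (w : wvec R n) e :
  oblivious A -> measurable_fun [set: T.-tuple (measurableTypeR R)]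
    (fun tape : T.-tuple R => output A eps w tape e : measurableTypeR R).
Proof.
move=> oA.
have [q [r [d [c [FE _ mc]]]]] : oblivious_conf (fun tape : T.-tuple R => run A
  T eps w tape).
  rewrite /run; have H t : oblivious_conf
      (fun tape : T.-tuple R => iter t (step tape) ([:: A], init_state eps w)).
    elim: t => [|t IH] /=; last exact: oblivious_step.
    exists [:: A], (ireg (init_state eps w)), 0%N, (fun=> cell (init_state eps
      w)).
    by split=> //=; rewrite ?oA.
  exact: H.
by rewrite /output; under eq_fun do rewrite FE /=; exact: mc.
Qed.

Lemma oblivious_measurable (A : cmd) (n : nat) (eps : R) :
  oblivious A -> measurable_mechanism (@output R A T n eps : _ -> T.-tuple
    (measurableTypeR R) -> _).
Proof.
move=> oA w _ S mS.
(* The sets with measurable preimage form a sigma-algebra containing the coordinate cylinders, hence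
   the generated one. *)
pose G := [set S : set (wvec R n) |
  @measurable _ (T.-tuple (measurableTypeR R)) (output A eps w @^-1` S)].
apply: (mS G); split.
  split; rewrite /G /=.
  - by rewrite preimage_set0.
  - move=> B mB; rewrite setTD preimage_setC; exact: measurableC.
  - by move=> F mF; rewrite preimage_bigcup; exact: bigcup_measurable.
move=> _ [e _ [B mB <-]]; rewrite /G /= setTI.
have := @measurable_output_coord A n eps w e oA measurableT B mB.
by rewrite setTI.
Qed.

End Oblivious.

(** * Uniform variates *)

Section Uniform.
Variable R : realType.
Local Notation mu := (@lebesgue_measure R).
Local Notation RR := (measurableTypeR R).
Implicit Types (A : set RR) (C : R).

Lemma uniform01E A : measurable A -> uniform01 R A = mu (A `&` `[0, 1]).
Proof.
move=> mA; rewrite /uniform01 /= /uniform_prob integral_uniform_pdf.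
have m01 : measurable (A `&` `[0, 1]%classic) by apply: measurableI.
rewrite (eq_integral (cst 1%E)); first by rewrite integral_cst // mul1e.
move=> x; rewrite inE => -[_ /=]; rewrite in_itv /= /uniform_pdf => ->.
by rewrite subr0 invr1.
Qed.

(* Lebesgue measure is an infimum over countable coverings by intervals. *)
Lemma measure_le_lebesgue (nu : {measure set RR -> \bar R}) C : 0 < C ->
  (forall a b : R, (nu (`]a, b]%classic : set RR) <= C%:E * mu `]a,
    b]%classic)%E) ->
  forall A, measurable A -> (nu A <= C%:E * mu A)%E.
Proof.
move=> C0 nuC A mA; rewrite -lee_pdivrMl //.
rewrite {1}/lebesgue_measure /= /lebesgue_stieltjes_measure /=
  /measure_extension /=.
apply: le_ereal_inf_tmp => _ [F [mF AF] <-].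
rewrite lee_pdivrMl // -nneseriesZl //.
have mF' k : @measurable _ RR (F k) by exact: sub_sigma_algebra.
apply: le_trans (measure_sigma_subadditive nu mF' mA AF) _.
apply: lee_nneseries => // k _.
have [[a b] _ <-] := mF k.
apply: le_trans (nuC a b) _.
rewrite lee_pmul2l // /lebesgue_measure /= /lebesgue_stieltjes_measure /=
  /measure_extension /=.
by rewrite measurable_mu_extE //; exact: is_ocitv.
Qed.

(** [A] lies between its infimum and its supremum. This measures the preimage of an interval under
    an expanding map without any change of variables. *)
Lemma lebesgue_diameter A d : measurable A -> 0 <= d ->
  (forall x y : R, A x -> A y -> x <= y -> y - x <= d) -> (mu A <= d%:E)%E.
Proof.
move=> mA d0 Ad; have [->|/set0P A0] := eqVneq A set0.
  by rewrite measure0 lee_fin.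
have Ad' x y : A x -> A y -> y <= x + d.
  move=> Ax Ay; have [xy|/ltW yx] := leP x y; first by rewrite -lerBlDl Ad.
  by rewrite (le_trans yx) // lerDl.
have [x0 Ax0] := A0.
have sl x : A x -> sup A <= x + d by move=> Ax; apply: ge_sup => // y;
  exact: Ad'.
have ub : has_ubound A by exists (x0 + d) => y; exact: Ad'.
have lb : has_lbound A by exists (x0 - d) => y Ay; rewrite lerBlDr Ad'.
have sd : sup A - d <= inf A.
  by apply: lb_le_inf => // x /sl; rewrite lerBlDr.
apply: (@le_trans _ _ (mu `[inf A, sup A]%classic)).
  apply: le_measure; rewrite ?inE //.
  by move=> x Ax /=; rewrite in_itv /= ub_le_sup ?ge_inf.
rewrite lebesgue_measure_itv /= lte_fin; case: ifP => _; rewrite lee_fin //.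
by rewrite lerBlDr addrC -lerBlDr.
Qed.

(** The preimage of an interval of length [l] has diameter at most [C * l]; domination on intervals
    extends to all measurable sets by [measure_le_lebesgue]. *)
Lemma uniform01_expanding (f : {mfun RR >-> RR}) C : 0 < C ->
  (forall x, 0 <= x <= 1 -> 0 <= f x <= 1) ->
  (forall x y, 0 <= x -> x <= y -> y <= 1 -> y - x <= C * (f y - f x)) ->
  forall A, measurable A -> (uniform01 R (f @^-1` A) <= C%:E * uniform01 R A)%E.
Proof.
move=> C0 f01 fC A mA.
have mpre B : measurable B -> @measurable _ RR (f @^-1` B).
  by move=> mB; rewrite -[_ @^-1` _]setTI; exact: measurable_funP.
rewrite [X in (_ <= _ * X)%E]uniform01E //.
have -> : uniform01 R (f @^-1` A) = uniform01 R (f @^-1` (A `&` `[0, 1])).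
  rewrite !uniform01E; last 2 first.
  - by apply: mpre; exact: measurableI.
  - exact: mpre.
  congr (mu _); apply/seteqP; split=> x /= [].
  - by move=> Af; rewrite !in_itv /= => x01; rewrite x01 f01.
  - by move=> [].
apply: (@measure_le_lebesgue (distribution (uniform01 R) f)) => //;
  last exact: measurableI.
move=> a b; rewrite [X in (X <= _)%E]uniform01E; last exact: mpre.
have [ab|ba] := ltP a b; last first.
  rewrite set_itv_ge; last by rewrite bnd_simp -leNgt.
  by rewrite preimage_set0 set0I !measure0 mule0.
rewrite lebesgue_measure_itv /= lte_fin ab -EFinD -EFinM.
apply: lebesgue_diameter.
- by apply: measurableI => //; exact: mpre.
- by rewrite mulr_ge0 ?subr_ge0 // ltW.
move=> x y /= []; rewrite !in_itv /= => /andP[ax xb] /andP[x0 x1].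
move=> [/andP[ay yb] /andP[y0 y1]] xy.
apply: le_trans (fC _ _ x0 xy y1) _; rewrite ler_pM2l //.
by rewrite lerB // ltW.
Qed.

(** The Moebius map multiplying the odds [x / (1 - x)] by [t]. Seen through [logit] it is the
    translation by [ln t]. *)
Definition odds_shift (t : R) : RR -> RR :=
  fun x : R => x * t / (1 - x + x * t) : R.

Lemma odds_shift_den (t x : R) : 0 < t -> 0 <= x <= 1 -> 0 < 1 - x + x * t.
Proof.
move=> t0 /andP[x0 x1]; have [->|/eqP x1'] := eqVneq x 1;
  first by rewrite subrr add0r mul1r.
by rewrite ltr_pwDl // ?mulr_ge0 ?(ltW t0) // subr_gt0 lt_neqAle; apply/andP;
  split=> //; apply/eqP.
Qed.

Lemma measurable_odds_shift (t : R) :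
  measurable_fun [set: RR] (odds_shift t : RR -> RR).
Proof.
have mid : measurable_fun [set: RR] (id : RR -> RR) by [].
have mM : measurable_fun [set: RR] (fun x : RR => x * t : RR).
  by apply: measurable_funM.
apply: measurable_funM => //; apply: (measurableT_comp (@measurable_invr R)).
by apply: measurable_funD => //; apply: measurable_funB.
Qed.

HB.instance Definition _ (t : R) :=
  isMeasurableFun.Build _ _ _ _ (odds_shift t) (measurable_odds_shift t).

(** The difference quotient is [t / (X * Y)] with both denominators at most [max 1 t], hence at
    least [min t (1 / t)], which the two hypotheses on [C] bound below by [1 / C]. *)
Lemma uniform01_odds_shift (t C : R) : 0 < t -> t <= C -> 1 <= C * t ->
  forall A, measurable A ->
  (uniform01 R (odds_shift t @^-1` A) <= C%:E * uniform01 R A)%E.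
Proof.
move=> t0 tC Ct.
have C0 : 0 < C by exact: lt_le_trans tC.
refine (@uniform01_expanding [the {mfun RR >-> RR} of odds_shift t] C C0 _ _)
  => /=.
- move=> x x01; have d0 := odds_shift_den t0 x01; case/andP: x01 => x0 x1.
  rewrite /odds_shift divr_ge0 ?mulr_ge0 ?(ltW t0) ?(ltW d0) //=.
  by rewrite ler_pdivrMr // mul1r lerDr subr_ge0.
- move=> x y x0 xy y1.
  have x01 : 0 <= x <= 1 by rewrite x0 (le_trans xy).
  have y01 : 0 <= y <= 1 by rewrite y1 (le_trans x0).
  have dx := odds_shift_den t0 x01; have dy := odds_shift_den t0 y01.
  set X := 1 - x + x * t in dx *; set Y := 1 - y + y * t in dy *.
  have -> : odds_shift t y - odds_shift t x = t * (y - x) / (X * Y).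
    by rewrite /odds_shift -/X -/Y /X /Y; field; rewrite -/X -/Y !gt_eqF.
  rewrite !mulrA ler_pdivlMr ?mulr_gt0 // [leLHS]mulrC ler_wpM2r ?subr_ge0 //.
  have [t1|t1] := leP t 1.
    have : X <= 1 by rewrite /X; nra.
    have : Y <= 1 by rewrite /Y; nra.
    by nra.
  have : X <= t by rewrite /X; nra.
  have : Y <= t by rewrite /Y; nra.
  move=> Yt Xt; apply: (@le_trans _ _ (t * t)); first by rewrite ler_pM // ltW.
  by rewrite ler_pM2r.
Qed.

Lemma uniform01_itvC (d : R) : 0 <= d -> d <= 1 / 2 ->
  uniform01 R (~` `[d, 1 - d]%classic) = (2 * d)%:E.
Proof.
move=> d0 d1; rewrite uniform01E; last by apply: measurableC.
rewrite setIC -setDE measureD //=; last by rewrite lebesgue_measure_itv /=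
  lte_fin ltr01 ltry.
rewrite setIidr; last first.
  move=> x /=; rewrite !in_itv /= => /andP[dx xd].
  by rewrite (le_trans d0 dx) (le_trans xd) // gerBl.
rewrite !lebesgue_measure_itv /= !lte_fin ltr01.
case: ltP => h; rewrite -?EFinD; congr EFin; first by ring.
have -> : d = 1 / 2 by lra.
by rewrite !subr0 mulrCA divff ?mulr1 ?pnatr_eq0.
Qed.

End Uniform.

(** * The law of the tape *)

Section TapeLaw.
Variable R : realType.
Local Notation RR := (measurableTypeR R).

Definition map_coord (m k : nat) (f : RR -> RR) (t : m.-tuple RR) : m.-tuple RR
  :=
  [tuple (if i == k :> nat then f (tnth t i) else tnth t i) | i < m].

Lemma nth_map_coord (m k : nat) f (t : m.-tuple RR) (i : nat) : (i < m)%N ->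
  nth 0 (map_coord k f t) i = if i == k then f (nth 0 t i) else nth 0 t i.
Proof.
move=> im; rewrite -(tnth_nth 0 (map_coord k f t) (Ordinal im)) tnth_mktuple /=.
by rewrite !(tnth_nth 0).
Qed.

Lemma map_coord_cons0 m f (x : RR) (t : m.-tuple RR) :
  map_coord 0 f (tape_cons (x, t)) = tape_cons (f x, t).
Proof.
apply: eq_from_tnth => i; rewrite tnth_mktuple.
by case: (unliftP ord0 i) => [j|] -> //=; rewrite !tnthS.
Qed.

Lemma map_coord_consS m k f (x : RR) (t : m.-tuple RR) :
  map_coord k.+1 f (tape_cons (x, t)) = tape_cons (x, map_coord k f t).
Proof.
apply: eq_from_tnth => i; rewrite tnth_mktuple.
by case: (unliftP ord0 i) => [j|] -> //=; rewrite !tnthS tnth_mktuple.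
Qed.

Lemma measurable_map_coord m k (f : RR -> RR) : measurable_fun setT f ->
  measurable_fun setT (@map_coord m k f).
Proof.
move=> mf; apply/measurable_fun_tnthP => i.
rewrite (_ : _ \o _ = fun t => if i == k :> nat then f (tnth t i) else tnth t
  i).
  case: eqP => _; last exact: measurable_tnth.
  by apply: (measurableT_comp mf); exact: measurable_tnth.
by apply/funext => t /=; rewrite tnth_mktuple.
Qed.

Lemma measurable_tape_cons_pre m (A : set (m.+1.-tuple RR)) : measurable A ->
  measurable (@tape_cons R m @^-1` A).
Proof.
move=> mA; rewrite -[_ @^-1` _]setTI.
have mc : measurable_fun setT (@tape_cons R m) by apply: measurable_cons.
exact: mc.
Qed.

Local Open Scope ereal_scope.

Lemma tape_lawSl m (A : set (m.+1.-tuple RR)) : measurable A ->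
  tape_law R m.+1 A =
  \int[uniform01 R]_x tape_law R m (xsection (@tape_cons R m @^-1` A) x).
Proof. by []. Qed.

(** Fubini with the first variate innermost, needed when the transformed coordinate is the head;
    [tape_lawSl] serves the tail. *)
Lemma tape_lawSr m (A : set (m.+1.-tuple RR)) : measurable A ->
  tape_law R m.+1 A =
  \int[tape_law R m]_t uniform01 R (ysection (@tape_cons R m @^-1` A) t).
Proof.
move=> mA; rewrite [LHS]tape_lawSl //.
apply: (@product_measure_unique _ _ _ _ R (uniform01 R) (tape_law R m)
   (uniform01 R \x^ tape_law R m)).
- by move=> X Y mX mY; exact: product_measure2E.
- exact: measurable_tape_cons_pre.
Qed.

(** Sections of the preimage are preimages of sections, under [f] for the head and under
    [map_coord k f] for the tail, so the one-variable bound integrates to the whole tape. *)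
Lemma tape_law_map_coord (f : RR -> RR) (C : R) : (0 <= C)%R ->
  measurable_fun setT f ->
  (forall Y, measurable Y -> uniform01 R (f @^-1` Y) <= C%:E * uniform01 R Y) ->
  forall m k (A : set (m.-tuple RR)), (k < m)%N -> measurable A ->
  tape_law R m (map_coord k f @^-1` A) <= C%:E * tape_law R m A.
Proof.
move=> C0 mf fC; elim=> [//|m IH] [|k] A km mA.
- have mA' : measurable (map_coord 0 f @^-1` A).
    by rewrite -[_ @^-1` _]setTI; exact: measurable_map_coord.
  have mY B : measurable B -> measurable_fun setT
      (fun t => uniform01 R (ysection (@tape_cons R m @^-1` B) t)).
    move=> mB; apply: (@measurable_fun_ysection _ _ _ _ R (uniform01 R)).
    exact: measurable_tape_cons_pre.
  rewrite !tape_lawSr // -ge0_integralZl //; last exact: mY.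
  apply: ge0_le_integral => //; [exact: mY|by apply: (measurable_funeM (C%:E)
    (mY A mA))|].
  move=> t _; apply: le_trans (fC _ _); last first.
    by apply: measurable_ysection; exact: measurable_tape_cons_pre.
  rewrite le_eqVlt; apply/orP; left; apply/eqP; congr (uniform01 R _).
  by apply/seteqP; split=> x; rewrite /= !ysectionE /= map_coord_cons0.
- have mA' : measurable (map_coord k.+1 f @^-1` A).
    by rewrite -[_ @^-1` _]setTI; exact: measurable_map_coord.
  have mX B : measurable B -> measurable_fun setT
      (fun x => tape_law R m (xsection (@tape_cons R m @^-1` B) x)).
    move=> mB; apply: (@measurable_fun_xsection _ _ _ _ R (tape_law R m)).
    exact: measurable_tape_cons_pre.
  rewrite !tape_lawSl // -ge0_integralZl //; last exact: mX.
  apply: ge0_le_integral => //; [exact: mX|by apply: (measurable_funeM (C%:E)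
    (mX A mA))|].
  move=> x _; apply: le_trans (IH k _ _ _) => //; last first.
    by apply: measurable_xsection; exact: measurable_tape_cons_pre.
  rewrite le_eqVlt; apply/orP; left; apply/eqP; congr (tape_law R m _).
  by apply/seteqP; split=> t; rewrite /= !xsectionE /= map_coord_consS.
Qed.

Lemma tape_law_coord (Y : set RR) : measurable Y ->
  forall m k, (k < m)%N ->
  tape_law R m [set t : m.-tuple RR | Y (nth 0%R t k)] = uniform01 R Y.
Proof.
move=> mY; elim=> [//|m IH] [|k] km.
- rewrite [LHS](_ : _ = (uniform01 R \x tape_law R m) (Y `*` setT)).
    by rewrite product_measure1E // [X in _ * X]probability_setT mule1.
  by congr (product_measure1 _ _ _); apply/seteqP; split=> -[x t] //= -[].
- rewrite [LHS](_ : _ = (uniform01 R \x tape_law R m)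
      (setT `*` [set t : m.-tuple RR | Y (nth 0%R t k)])); last first.
    by congr (product_measure1 _ _ _); apply/seteqP; split=> -[x t] //= -[].
  rewrite product_measure1E //; first by rewrite [X in X * _]probability_setT
    mul1e; exact: IH.
  by have := @measurable_nth_tuple R m k measurableT Y mY; rewrite setTI.
Qed.

End TapeLaw.

(** * Laplacians and their quadratic forms *)

Section Forms.
Variables (R : realType) (n : nat).
Implicit Types (w : wvec R n) (x y z : 'rV[R]_n) (u v : 'I_n) (e : upair n).

Definition lo e : 'I_n := (val e).1.
Definition hi e : 'I_n := (val e).2.

Lemma edge_coordC w u v : edge_coord w u v = edge_coord w v u.
Proof.
rewrite /edge_coord; case: insubP => [e /= uv _|];
  case: insubP => [e' /= vu _|] //.
by have := ltn_trans uv vu; rewrite ltnn.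
Qed.

Lemma edge_coord_diag w u : edge_coord w u u = 0.
Proof. by rewrite /edge_coord; case: insubP => //= e; rewrite ltnn. Qed.

Lemma edge_coordE w e : edge_coord w (lo e) (hi e) = w e.
Proof.
by rewrite /edge_coord /lo /hi -surjective_pairing valK.
Qed.

Lemma edge_coordE' w e : edge_coord w (hi e) (lo e) = w e.
Proof. by rewrite edge_coordC edge_coordE. Qed.

Lemma edge_coord_some w u v : u != v ->
  exists e, edge_coord w u v = w e /\ (u = lo e /\ v = hi e \/ v = lo e /\ u =
    hi e).
Proof.
rewrite neq_ltn => /orP[uv|vu].
  by exists (Sub (u, v) uv); rewrite -edge_coordE; split; [|left].
by exists (Sub (v, u) vu); rewrite -edge_coordE'; split; [|right].
Qed.

Lemma edge_coord_ge0 w u v : nonneg_wvec w -> 0 <= edge_coord w u v.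
Proof.
move=> w0; have [->|/(edge_coord_some w)[e [-> _]]] := eqVneq u v;
  last exact: w0.
by rewrite edge_coord_diag.
Qed.

Lemma sum_pairs (f : 'I_n -> 'I_n -> R) : (forall u, f u u = 0) ->
  \sum_u \sum_v f u v = \sum_e (f (lo e) (hi e) + f (hi e) (lo e)).
Proof.
move=> f0; rewrite big_split /= pair_big /=.
rewrite (bigID (fun p : 'I_n * 'I_n => (p.1 < p.2)%N)) /=; congr (_ + _).
  rewrite (reindex_omap (val : upair n -> _) insub) /=; last first.
    by move=> p up; rewrite insubT.
  by apply: eq_bigl => e; rewrite valK eqxx andbT; exact: (valP e).
rewrite (bigID (fun p : 'I_n * 'I_n => p.1 == p.2)) /= big1 ?add0r; last first.
  by move=> [u v] /= /andP[_ /eqP->].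
rewrite (reindex_omap (fun e : upair n => (hi e, lo e))
   (fun p => insub (p.2, p.1))) /=; last first.
  move=> [u v] /=; rewrite -leqNgt => /andP[vu ne].
  by rewrite insubT //= ltn_neqAle vu eq_sym andbT.
apply: eq_bigl => e; rewrite -surjective_pairing valK eqxx andbT.
by rewrite -leqNgt ltnW ?(valP e) //= eq_sym neq_ltn (valP e).
Qed.

Lemma sum_edge_coord w (f : 'I_n -> 'I_n -> R) :
  \sum_u \sum_v edge_coord w u v * f u v =
  \sum_e w e * (f (lo e) (hi e) + f (hi e) (lo e)).
Proof.
rewrite (sum_pairs (f := fun u v => edge_coord w u v * f u v)); last first.
  by move=> u; rewrite edge_coord_diag mul0r.
by apply: eq_bigr => e _; rewrite edge_coordE edge_coordE' mulrDr.
Qed.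

Definition dot x y : R := \sum_i x 0 i * y 0 i.
Definition vsum x : R := \sum_i x 0 i.
Definition energy w x y : R :=
  \sum_e w e * ((x 0 (lo e) - x 0 (hi e)) * (y 0 (lo e) - y 0 (hi e))).

Lemma dotC x y : dot x y = dot y x.
Proof. by apply: eq_bigr => i _; rewrite mulrC. Qed.

Lemma energyC w x y : energy w x y = energy w y x.
Proof. by apply: eq_bigr => e _; rewrite [X in _ * X]mulrC. Qed.

Lemma dotDl x y z : dot (x + y) z = dot x z + dot y z.
Proof. by rewrite -big_split; apply: eq_bigr => i _; rewrite mxE mulrDl. Qed.

Lemma dotZl a x y : dot (a *: x) y = a * dot x y.
Proof. by rewrite mulr_sumr; apply: eq_bigr => i _; rewrite mxE mulrA. Qed.

Lemma energyDl w x y z : energy w (x + y) z = energy w x z + energy w y z.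
Proof. by rewrite -big_split; apply: eq_bigr => i _; rewrite !mxE /=; ring. Qed.

Lemma energyZl w a x y : energy w (a *: x) y = a * energy w x y.
Proof. by rewrite mulr_sumr; apply: eq_bigr => i _; rewrite !mxE /=; ring. Qed.

Lemma dotDr x y z : dot x (y + z) = dot x y + dot x z.
Proof. by rewrite dotC dotDl !(dotC x). Qed.

Lemma dotZr a x y : dot x (a *: y) = a * dot x y.
Proof. by rewrite dotC dotZl (dotC x). Qed.

Lemma energyDr w x y z : energy w x (y + z) = energy w x y + energy w x z.
Proof. by rewrite energyC energyDl !(energyC w x). Qed.

Lemma energyZr w a x y : energy w x (a *: y) = a * energy w x y.
Proof. by rewrite energyC energyZl (energyC w x). Qed.

Lemma dot_ge0 x : 0 <= dot x x.
Proof. by apply: sumr_ge0 => i _; rewrite -expr2 sqr_ge0. Qed.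

Lemma dot_eq0 x : dot x x = 0 -> x = 0.
Proof.
move=> /eqP; rewrite psumr_eq0 => [/allP x0|i _];
  last by rewrite -expr2 sqr_ge0.
apply/rowP => i; rewrite mxE; apply/eqP.
by have := x0 i (mem_index_enum i); rewrite /= -expr2 sqrf_eq0.
Qed.

Lemma energy_ge0 w x : nonneg_wvec w -> 0 <= energy w x x.
Proof. by move=> w0; apply: sumr_ge0 => e _; rewrite mulr_ge0 // -expr2
  sqr_ge0. Qed.

Lemma vsumE x : vsum x = dot x (const_mx 1).
Proof. by apply: eq_bigr => i _; rewrite mxE mulr1. Qed.

Lemma dot_laplacian w x y : dot (x *m laplacian w) y = energy w x y.
Proof.
transitivity (\sum_u \sum_v edge_coord w u v * ((x 0 v - x 0 u) * y 0 v)).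
  rewrite exchange_big; apply: eq_bigr => v _.
  rewrite /laplacian mulmxBr !mxE mulrBl.
  rewrite (bigD1 v) //= big1 ?addr0 => [|u uv]; last first.
    by rewrite !mxE (negbTE uv) mulr0n mulr0.
  rewrite !mxE eqxx mulr1n /wdegree mulr_sumr !mulr_suml -sumrB.
  by apply: eq_bigr => u _; rewrite !mxE (edge_coordC w v u); ring.
rewrite sum_edge_coord; apply: eq_bigr => e _; ring.
Qed.

Lemma const_laplacian w a : const_mx a *m laplacian w = 0 :> 'rV_n.
Proof.
apply: dot_eq0; rewrite dot_laplacian; apply: big1 => e _.
by rewrite !mxE subrr mul0r mulr0.
Qed.

Lemma vsum_laplacian w x : vsum (x *m laplacian w) = 0.
Proof.
by rewrite vsumE dot_laplacian energyC -dot_laplacian const_laplacian -(scale0r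
  0) dotZl mul0r.
Qed.

(** Connectedness in algebraic form. For the sanitized graph, which may have lost edges, it follows
    from a spectral bound, with no reasoning on paths. *)
Definition definite w := forall x, vsum x = 0 -> energy w x x = 0 -> x = 0.

Lemma energy_eq0 w x : nonneg_wvec w -> energy w x x = 0 ->
  forall e, w e != 0 -> x 0 (lo e) = x 0 (hi e).
Proof.
move=> w0 /eqP; rewrite psumr_eq0 => [/allP H e we|e _]; last first.
  by rewrite mulr_ge0 // -expr2 sqr_ge0.
have := H e (mem_index_enum e).
by rewrite /= mulf_eq0 (negbTE we) /= -expr2 sqrf_eq0 subr_eq0 => /eqP.
Qed.

Lemma connected_definite w : nonneg_wvec w -> connected_graph w -> definite w.
Proof.
move=> w0 cw x x0 fx.
have adjE u v : adj w u v -> x 0 u = x 0 v.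
  rewrite /adj; have [->//|uv] := eqVneq u v.
  have [e [-> H]] := edge_coord_some w uv; move=> /(energy_eq0 w0 fx) E.
  by case: H => -[-> ->].
have cst u v : x 0 u = x 0 v.
  have /connectP[p pp ->] := cw u v.
  by elim: p u pp => //= z p IH u /andP[/adjE-> /IH].
apply: dot_eq0; case: (pickP (fun _ : 'I_n => true)) => [u _|no]; last first.
  by rewrite /dot big1 // => i _; have := no i.
rewrite /dot (eq_bigr (fun i => x 0 u * x 0 i)) => [|i _];
  last by rewrite (cst i u).
by rewrite -mulr_sumr [X in _ * X]x0 mulr0.
Qed.

Lemma quadratic_nonneg_lin0 (a b : R) : (forall t, 0 <= t * (2 * a) + t ^+ 2 *
  b) -> a = 0.
Proof.
move=> H; have b0 : 0 <= b by have := H 1; have := H (-1); lra.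
have b1 : 0 < 1 + b by lra.
(* The exact minimiser [- a / b] would require [b != 0]; with [1 + b] the value is still negative
   unless [a = 0]. *)
have := H (- a / (1 + b)).
rewrite (_ : _ + _ = - (a ^+ 2 * (2 + b) / (1 + b) ^+ 2)); last first.
  by field; rewrite gt_eqF.
rewrite oppr_ge0 pmulr_lle0 ?invr_gt0 ?exprn_gt0 // pmulr_lle0; last by lra.
by move=> a2; apply/eqP; rewrite -sqrf_eq0 eq_le a2 sqr_ge0.
Qed.

Lemma continuous_sum_fun (T : topologicalType) (I : Type) (r : seq I) (f : I ->
  T -> R) :
  (forall i, continuous (f i)) -> continuous (fun p => \sum_(i <- r) f i p).
Proof.
move=> cf; elim: r => [|i r IH] p.
  by under eq_fun do rewrite big_nil; exact: cvg_cst.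
by under eq_fun do rewrite big_cons; apply: cvgD; [exact: cf|exact: IH].
Qed.

Lemma continuous_coord i : continuous (fun x : 'rV[R]_n => x 0 i).
Proof. exact: coord_continuous. Qed.

Lemma continuous_energy w : continuous (fun x => energy w x x).
Proof.
apply: continuous_sum_fun => e x.
have c1 : {for x, continuous (fun y : 'rV[R]_n => y 0 (lo e) - y 0 (hi e))}.
  by apply: continuousB; exact: continuous_coord.
apply: (@continuousM R 'rV[R]_n (fun=> w e) (fun y => (y 0 (lo e) - y 0 (hi e))
  * (y 0 (lo e) - y 0 (hi e)))).
  exact: cst_continuous.
exact: continuousM.
Qed.

Lemma continuous_dot : continuous (fun x => dot x x).
Proof.
by apply: continuous_sum_fun => i x; apply: continuousM;
  exact: continuous_coord.
Qed.

Lemma continuous_vsum : continuous vsum.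
Proof. by apply: continuous_sum_fun => i x; exact: continuous_coord. Qed.

Let sphere := [set x | dot x x = 1 /\ vsum x = 0].

Let compact_sphere : compact sphere.
Proof.
have cbox : compact [set x : 'rV[R]_n | forall i, `[(-1 : R), 1]%classic (x
  ord0 i)].
  by apply: (@rV_compact _ _ (fun=> `[(-1 : R), 1]%classic)) => i;
    exact: segment_compact.
have cl1 (a : R) : closed [set a] by
  exact/accessible_closed_set1/hausdorff_accessible/Rhausdorff.
apply: subclosed_compact cbox _.
  rewrite (_ : sphere = (fun x => dot x x) @^-1` [set 1] `&` vsum @^-1` [set
    0]) //.
  apply: closedI; apply: preimage_closed => // x _.
  + exact: continuous_dot.
  + exact: continuous_vsum.
move=> x [x1 _] i /=; rewrite in_itv /= -ler_norml -(@ler_pXn2r _ 2) ?nnegrE //.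
rewrite expr1n real_normK ?num_real // -x1 /dot (bigD1 i) //= -expr2 lerDl.
by apply: sumr_ge0 => j _; rewrite -expr2 sqr_ge0.
Qed.

Lemma vsumD x y : vsum (x + y) = vsum x + vsum y.
Proof. by rewrite !vsumE dotDl. Qed.

Lemma vsumZ a x : vsum (a *: x) = a * vsum x.
Proof. by rewrite !vsumE dotZl. Qed.

Lemma dot_scale a x : dot (a *: x) (a *: x) = a ^+ 2 * dot x x.
Proof. by rewrite dotZl dotC dotZl mulrA. Qed.

Lemma energy_scale w a x : energy w (a *: x) (a *: x) = a ^+ 2 * energy w x x.
Proof. by rewrite energyZl energyC energyZl mulrA. Qed.

Definition pair_vec u v : 'rV[R]_n := delta_mx 0 u - delta_mx 0 v.

Lemma dot_delta x u : dot x (delta_mx 0 u) = x 0 u.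
Proof.
rewrite /dot (bigD1 u) //= big1 => [|i iu]; first by rewrite mxE !eqxx mulr1
  addr0.
by rewrite mxE (negbTE iu) andbF mulr0.
Qed.

Lemma dot_pair x u v : dot x (pair_vec u v) = x 0 u - x 0 v.
Proof. by rewrite dotC dotDl -scaleN1r dotZl ![dot (delta_mx _ _) _]dotC
  !dot_delta mulN1r. Qed.

Lemma vsum_delta u : vsum (delta_mx 0 u) = 1.
Proof. by rewrite vsumE dotC dot_delta mxE. Qed.

Lemma vsum_pair u v : vsum (pair_vec u v) = 0.
Proof. by rewrite vsumD -scaleN1r vsumZ !vsum_delta mulN1r subrr. Qed.

Lemma dot_pair_pair u v : u != v -> dot (pair_vec u v) (pair_vec u v) = 2.
Proof.
move=> uv; rewrite dot_pair !mxE !eqxx /= [v == u]eq_sym (negbTE uv).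
by rewrite subr0 sub0r opprK.
Qed.

(* On the hyperplane orthogonal to the constants, a minimiser of the Rayleigh
   quotient is an eigenvector, so that the minimum is [lambda w]. *)
Lemma lambda_rayleigh w : (1 < n)%N -> nonneg_wvec w -> definite w ->
  0 < lambda w /\ forall x, vsum x = 0 -> lambda w * dot x x <= energy w x x.
Proof.
move=> n1 w0 dw.
have unit_of x : x != 0 -> vsum x = 0 ->
    exists2 a, 0 < a & sphere (a *: x) /\ a ^+ 2 * dot x x = 1.
  move=> x0 tx.
  have d0 : 0 < dot x x.
    by rewrite lt_neqAle dot_ge0 andbT eq_sym;
      apply: contra x0 => /eqP/dot_eq0->.
  have E : (Num.sqrt (dot x x))^-1 ^+ 2 * dot x x = 1.
    by rewrite exprVn sqr_sqrtr ?dot_ge0 // mulVf // gt_eqF.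
  exists (Num.sqrt (dot x x))^-1; first by rewrite invr_gt0 sqrtr_gt0.
  by split=> //; split; rewrite ?dot_scale // vsumZ tx mulr0.
pose a0 : 'I_n := Ordinal (ltnW n1); pose a1 : 'I_n := Ordinal n1.
have [|x0 + min0] := EVT_min_rV _ compact_sphere (continuous_subspaceT
  (@continuous_energy w)).
  have a01 : pair_vec a0 a1 != 0.
    apply/eqP => p0; have := @dot_pair_pair a0 a1 isT.
    by rewrite p0 /dot big1 => [|i _]; [move/esym/eqP;
      rewrite pnatr_eq0|rewrite mxE mul0r].
  by have [a _ [Sa _]] := unit_of _ a01 (vsum_pair _ _);
    exists (a *: pair_vec a0 a1).
rewrite inE => -[x01 tx0].
set mm := energy w x0 x0.
have x0n0 : x0 != 0.
  apply/eqP => x00; move: x01; rewrite x00 /dot big1 => [/esym/eqP|i _].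
    by rewrite oner_eq0.
  by rewrite mxE mul0r.
have mm0 : 0 < mm.
  rewrite lt_neqAle energy_ge0 // andbT; apply/eqP => /esym /(dw _ tx0) E.
  by rewrite E eqxx in x0n0.
have ray x : vsum x = 0 -> mm * dot x x <= energy w x x.
  move=> tx; have [->|xn0] := eqVneq x 0.
    by rewrite -(scale0r 0) dot_scale energy_scale expr0n /= !mul0r mulr0.
  have [a a0' [Sa aE]] := unit_of _ xn0 tx.
  have := min0 (a *: x); rewrite inE => /(_ Sa); rewrite energy_scale -/mm => H.
  rewrite -(ler_pM2l (exprn_gt0 2 a0')) (le_trans _ H) //.
  by rewrite mulrCA aE mulr1.
have eig : eigenvalue (laplacian w) mm.
  apply/eigenvalueP; exists x0 => //.
  (* First variation of the Rayleigh quotient at its minimiser, along directions of sum zero. *)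
  have orth z : vsum z = 0 -> energy w x0 z - mm * dot x0 z = 0.
    move=> tz; apply: (@quadratic_nonneg_lin0 _ (energy w z z - mm * dot z z))
      => t.
    have := ray (x0 + t *: z); rewrite vsumD vsumZ tx0 tz mulr0 addr0 => /(_
      erefl).
    rewrite !(dotDl, dotDr, dotZl, dotZr, energyDl, energyDr, energyZl,
      energyZr).
    rewrite [dot z x0]dotC [energy w z x0]energyC x01 -/mm => H;
      rewrite -subr_ge0 in H.
    by apply: le_trans H _; rewrite le_eqVlt; apply/orP; left; apply/eqP; ring.
  (* The residual itself sums to zero, hence is an admissible direction; orthogonal to itself, it
     vanishes. *)
  pose r := x0 *m laplacian w - mm *: x0.
  have tr : vsum r = 0.
    by rewrite vsumD -scaleN1r !vsumZ vsum_laplacian tx0 !mulr0 addr0.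
  apply/eqP; rewrite -subr_eq0 -/r; apply/eqP/dot_eq0.
  by rewrite {1}/r dotDl -scaleN1r !dotZl dot_laplacian mulN1r orth.
have -> : lambda w = mm.
  (* An eigenvector for a nonzero eigenvalue sums to zero, because every image of the Laplacian
     does; the Rayleigh bound then applies to it. *)
  have lbE : lbound [set x | eigenvalue (laplacian w) x /\ x != 0] mm.
    move=> b /= [/eigenvalueP[x xE xn0] bn0].
    have tx : vsum x = 0.
      have := vsum_laplacian w x; rewrite xE vsumZ => /eqP.
      by rewrite mulf_eq0 (negbTE bn0) => /eqP.
    have := ray x tx; rewrite -dot_laplacian xE dotZl ler_pM2r //.
    by rewrite lt_neqAle dot_ge0 andbT eq_sym;
      apply: contra xn0 => /eqP/dot_eq0->.
  apply/eqP; rewrite eq_le; apply/andP; split.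
    by apply: ge_inf; [exists mm|split=> //; rewrite gt_eqF].
  by apply: lb_le_inf => //; exists mm; split=> //; rewrite gt_eqF.
by split.
Qed.

End Forms.

(** * Perturbation of effective resistances *)

Section Perturbation.
Variables (R : realType) (n : nat).
Implicit Types (w b : wvec R n) (x y z : 'rV[R]_n) (u v : 'I_n) (e : upair n).

Lemma sum_wdegree w : \sum_u wdegree w u = 2 * \sum_e w e.
Proof.
rewrite /wdegree (eq_bigr (fun u => \sum_v edge_coord w u v * 1)) => [|u _].
  by rewrite sum_edge_coord mulr_sumr; apply: eq_bigr => e _; ring.
by apply: eq_bigr => v _; rewrite mulr1.
Qed.

(** From [(p - q)^2 <= 2 p^2 + 2 q^2] on each edge: the square at a vertex is then counted twice its
    degree. *)
Lemma energy_le_degree b (beta : R) x : nonneg_wvec b ->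
  (forall u, wdegree b u <= beta) -> energy b x x <= 2 * beta * dot x x.
Proof.
move=> b0 bd.
have -> : 2 * beta * dot x x = \sum_u 2 * (beta * (x 0 u * x 0 u)).
  by rewrite -mulr_sumr -mulr_sumr mulrA.
apply: (@le_trans _ _ (\sum_u \sum_v edge_coord b u v * (2 * (x 0 u * x 0 u)))).
  rewrite sum_edge_coord; apply: ler_sum => e _; rewrite ler_wpM2l //.
  by have := sqr_ge0 (x 0 (lo e) + x 0 (hi e)); rewrite expr2; lra.
apply: ler_sum => u _; rewrite -mulr_suml mulrCA ler_wpM2l // ler_wpM2r ?bd //.
by rewrite -expr2 sqr_ge0.
Qed.

Lemma energy_delta w u v : energy w (delta_mx 0 u) (delta_mx 0 v) = laplacian w
  u v.
Proof. by rewrite -dot_laplacian dot_delta -rowE mxE. Qed.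

Lemma laplacian_diag w u : laplacian w u u = wdegree w u.
Proof. by rewrite !mxE eqxx mulr1n edge_coord_diag subr0. Qed.

Lemma energy_const w a x : energy w (const_mx a) x = 0.
Proof. by rewrite -dot_laplacian const_laplacian -(scale0r 0) dotZl mul0r. Qed.

Lemma dot_const x a : dot x (const_mx a) = a * vsum x.
Proof. by rewrite mulr_sumr; apply: eq_bigr => i _; rewrite mxE mulrC. Qed.

(** Serves to absorb the error on the total weight, which is proportional to [n], into a bound
    proportional to the weight itself. *)
Lemma norm1_lambda w (l : R) : (1 < n)%N -> 0 < l ->
  (forall x, vsum x = 0 -> l * dot x x <= energy w x x) ->
  n%:R * l <= 4 * \sum_e w e.
Proof.
move=> n1 l0 ray.
have nn0 : n%:R != 0 :> R by rewrite pnatr_eq0 -lt0n ltnW.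
have n0 : 0 < n%:R :> R by rewrite ltr0n ltnW.
have deg u : l * (1 - n%:R^-1) <= wdegree w u.
  (* Test vector: a point mass recentred to sum zero has energy the degree of [u] and squared norm
     [1 - 1/n]. Summing over [u], [n - 1 >= n / 2] yields the factor 4. *)
  pose x : 'rV[R]_n := delta_mx 0 u + const_mx (- n%:R^-1).
  have tc a : vsum (const_mx a : 'rV[R]_n) = n%:R * a.
    by rewrite /vsum (eq_bigr (fun=> a)) ?sumr_const ?card_ord ?mulr_natl // =>
      i _; rewrite mxE.
  have tx : vsum x = 0 by rewrite vsumD vsum_delta tc mulrN divff // subrr.
  have fx : energy w x x = wdegree w u.
    rewrite energyDl energyDr energy_const [energy w (delta_mx _ _) (const_mx
      _)]energyC.
    by rewrite energy_const energy_delta laplacian_diag !addr0.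
  have dx : dot x x = 1 - n%:R^-1.
    rewrite {2}/x dotDr dot_delta dot_const tx mulr0 addr0 !mxE !eqxx.
    by [].
  by rewrite -fx -dx ray.
have : n%:R * (l * (1 - n%:R^-1)) <= \sum_u wdegree w u.
  rewrite (_ : n%:R * _ = \sum_(u < n) l * (1 - n%:R^-1)); last first.
    by rewrite sumr_const card_ord mulr_natl.
  by apply: ler_sum => u _.
rewrite sum_wdegree mulrCA mulrBr mulr1 divff // => H.
have : 2 <= n%:R :> R by rewrite ler_nat.
nra.
Qed.

Lemma potential_bound w (mu : R) x y : 0 < mu -> nonneg_wvec w ->
  mu * dot y y <= energy w y y -> y *m laplacian w = x ->
  [/\ dot y y <= dot x x / mu ^+ 2, 0 <= dot y x & dot y x <= dot x x / mu].
Proof.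
move=> mu0 w0 muy yx.
have fy : energy w y y = dot y x by rewrite -dot_laplacian yx dotC.
rewrite fy in muy.
have am : 2 * dot y x <= mu * dot y y + dot x x / mu.
  (* The arithmetic-geometric inequality in place of Cauchy-Schwarz; together with
     [mu * dot y y <= dot y x] it gives all three bounds. *)
  have := dot_ge0 (mu *: y + (-1) *: x).
  rewrite !(dotDl, dotDr, dotZl, dotZr) [dot x y]dotC => H.
  rewrite -(ler_pM2l mu0) mulrDr [mu * (_ / mu)]mulrC divfK ?gt_eqF //; lra.
have yb : mu * dot y y <= dot x x / mu by lra.
split.
- rewrite ler_pdivlMr ?exprn_gt0 // (_ : _ * _ = mu * dot y y * mu);
  last by ring.
  by rewrite -ler_pdivlMr.
- by rewrite -fy energy_ge0.
- by lra.
Qed.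

Lemma resistance_perturbation w w' b (l beta : R) x y y' :
  0 < l -> nonneg_wvec w -> nonneg_wvec w' ->
  (forall e, `|w' e - w e| <= b e) -> (forall u, wdegree b u <= beta) ->
  l * dot y y <= energy w y y -> l / 2 * dot y' y' <= energy w' y' y' ->
  y *m laplacian w = x -> y' *m laplacian w' = x ->
  `|dot y' x - dot y x| <= 5 * beta * dot x x / l ^+ 2.
Proof.
move=> l0 w0 w'0 wb bd ly ly' yx y'x.
have b0 : nonneg_wvec b by move=> e; exact: le_trans (wb e).
have l2 : 0 < l / 2 by rewrite divr_gt0.
have [yb _ _] := potential_bound l0 w0 ly yx.
have [y'b _ _] := potential_bound l2 w'0 ly' y'x.
have -> : dot y' x - dot y x =
    \sum_e (w e - w' e) * ((y' 0 (lo e) - y' 0 (hi e)) * (y 0 (lo e) - y 0 (hi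
      e))).
  rewrite -{1}yx dotC dot_laplacian energyC [dot y x]dotC -y'x dot_laplacian
    -sumrB.
  by apply: eq_bigr => e _; rewrite [RHS]mulrBl.
have fb : energy b y' y' + energy b y y <= 2 * beta * (dot y' y' + dot y y).
  by rewrite mulrDr lerD ?energy_le_degree.
have beta0 : 0 <= beta * dot x x.
  have [->|/eqP xn0] := eqVneq (dot x x) 0; first by rewrite mulr0.
  rewrite mulr_ge0 ?dot_ge0 //.
  case: (pickP (fun _ : 'I_n => true)) => [u _|no]; last first.
    by case: xn0; rewrite /dot big1 // => i; have := no i.
  by apply: le_trans (bd u); apply: sumr_ge0 => v _; exact: edge_coord_ge0.
apply: le_trans (ler_norm_sum _ _ _) _.
apply: (@le_trans _ _ ((energy b y' y' + energy b y y) / 2)).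
  rewrite /energy -big_split /= mulr_suml; apply: ler_sum => e _.
  rewrite normrM -mulrDr -mulrA ler_pM //; first by rewrite distrC.
  set p := _ - _; set q := _ - _.
  rewrite ler_norml; apply/andP; split.
    by have := sqr_ge0 (p + q); rewrite expr2; lra.
  by have := sqr_ge0 (p - q); rewrite expr2; lra.
(* Without vertices the degree bound is vacuous and [beta] may be negative; then all three vectors
   have norm 0. *)
have [bet0|bet0] := leP 0 beta; last first.
  have d0 : dot x x = 0.
    by apply/eqP; rewrite eq_le dot_ge0 andbT; have := dot_ge0 x; nra.
  rewrite d0 !mul0r in yb y'b.
  have [dy dy'] : dot y y = 0 /\ dot y' y' = 0.
    by split; apply/eqP; rewrite eq_le dot_ge0 ?yb ?y'b.
  by rewrite d0 dy dy' in fb *; rewrite mulr0 mul0r; lra.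
apply: (@le_trans _ _ (beta * (dot y' y' + dot y y))); first by lra.
(* 5 = 4 + 1: the potential [y'] is controlled with gap [l / 2], and [y] with gap [l]. *)
have -> : 5 * beta * dot x x / l ^+ 2 = beta * (dot x x / (l / 2) ^+ 2 + dot x
  x / l ^+ 2).
  by field; rewrite gt_eqF.
by rewrite ler_wpM2l // lerD.
Qed.

Lemma commute_perturbation w w' b (l beta : R) x y y' :
  (1 < n)%N -> 0 < l -> nonneg_wvec w -> nonneg_wvec w' ->
  (forall e, `|w' e - w e| <= b e) -> (forall u, wdegree b u <= beta) ->
  (forall z, vsum z = 0 -> l * dot z z <= energy w z z) ->
  (forall z, vsum z = 0 -> l / 2 * dot z z <= energy w' z z) ->
  vsum y = 0 -> vsum y' = 0 -> dot x x = 2 ->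
  y *m laplacian w = x -> y' *m laplacian w' = x ->
  `|2 * (\sum_e w' e) * dot y' x - 2 * (\sum_e w e) * dot y x|
   <= 36 * (\sum_e w e) * beta / l ^+ 2.
Proof.
move=> n1 l0 w0 w'0 wb bd lw lw' ty ty' xx yx y'x.
have b0 : nonneg_wvec b by move=> e; exact: le_trans (wb e).
have l2 : 0 < l / 2 by rewrite divr_gt0.
have P := resistance_perturbation l0 w0 w'0 wb bd (lw _ ty) (lw' _ ty') yx y'x.
have [_ y'0 y'b] := potential_bound l2 w'0 (lw' _ ty') y'x.
have nl := norm1_lambda n1 l0 lw.
set W := \sum_e w e in nl *; set W' := \sum_e w' e.
have W0 : 0 <= W by exact: sumr_ge0.
have beta0 : 0 <= beta.
  apply: le_trans (bd (Ordinal n1)); apply: sumr_ge0 => v _;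
    exact: edge_coord_ge0.
have WW : `|W' - W| <= n%:R * beta / 2.
  rewrite /W' /W -sumrB; apply: le_trans (ler_norm_sum _ _ _) _.
  apply: (@le_trans _ _ (\sum_e b e)); first exact: ler_sum.
  rewrite ler_pdivlMr // mulrC -sum_wdegree.
  rewrite (_ : n%:R * _ = \sum_(u < n) beta); last by rewrite sumr_const
    card_ord mulr_natl.
  exact: ler_sum.
rewrite xx in P y'b.
(* The first term costs [2 * (n * beta / 2) * (4 / l)], at most [16 * W * beta / l^2] by
   [norm1_lambda]; the second costs [20 * W * beta / l^2], whence 36. *)
have -> : 2 * W' * dot y' x - 2 * W * dot y x =
  2 * (W' - W) * dot y' x + 2 * W * (dot y' x - dot y x) by ring.
apply: le_trans (ler_normD _ _) _; rewrite !normrM ger0_norm // (ger0_norm W0)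
  (ger0_norm y'0).
have y'b4 : dot y' x <= 4 / l.
  by apply: le_trans y'b _; rewrite le_eqVlt; apply/orP; left; apply/eqP;
    field; rewrite gt_eqF.
have H1 : 2 * `|W' - W| * dot y' x <= n%:R * beta * (4 / l).
  by rewrite ler_pM // ?mulr_ge0 //; lra.
have H2 : 2 * W * `|dot y' x - dot y x| <= 2 * W * (5 * beta * 2 / l ^+ 2).
  by rewrite ler_wpM2l // mulr_ge0.
have H3 : n%:R * beta * (4 / l) <= 4 * W * beta * (4 / l ^+ 2).
  rewrite (_ : n%:R * beta * (4 / l) = (n%:R * l) * beta * (4 / l ^+ 2));
    last first.
    by field; rewrite gt_eqF.
  by rewrite ler_wpM2r ?ler_wpM2r // divr_ge0 ?exprn_ge0 // ltW.
apply: le_trans (lerD H1 H2) _; apply: le_trans (lerD H3 (lexx _)) _.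
by rewrite le_eqVlt; apply/orP; left; apply/eqP; field; rewrite gt_eqF.
Qed.

End Perturbation.

(** * Inverting the grounded Laplacian *)

Section Inverse.
Variables (R : realType) (n : nat).
Implicit Types (w b : wvec R n) (x y z : 'rV[R]_n) (u v : 'I_n) (e : upair n).

(* Adding the all-ones matrix makes the Laplacian of a connected graph
   invertible without changing it on vectors of sum zero. *)
Definition grounded w : 'M[R]_n := laplacian w + const_mx 1.

Lemma mul_ones x : x *m const_mx 1 = const_mx (vsum x) :> 'rV[R]_n.
Proof. by apply/rowP => i; rewrite !mxE; apply: eq_bigr => j _;
  rewrite mxE mulr1. Qed.

Lemma mul_grounded w x : x *m grounded w = x *m laplacian w + const_mx (vsum x).
Proof. by rewrite mulmxDr mul_ones. Qed.

(** The quadratic form of [grounded w] is the energy plus the square of the coordinate sum, and both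
    must vanish. *)
Lemma grounded_kernel w x : nonneg_wvec w -> definite w -> x *m grounded w = 0
  -> x = 0.
Proof.
move=> w0 dw; rewrite mul_grounded => E.
have : energy w x x + vsum x * vsum x = 0.
  by rewrite -dot_laplacian -dot_const [dot x (const_mx _)]dotC -dotDl E
    -(scale0r 0) dotZl mul0r.
move=> /eqP; rewrite paddr_eq0 ?energy_ge0 // -?expr2 ?sqr_ge0 // sqrf_eq0.
by case/andP => /eqP e0 /eqP v0; exact: (dw x).
Qed.

Lemma grounded_unit w : nonneg_wvec w -> definite w -> grounded w \in unitmx.
Proof.
move=> w0 dw; rewrite -row_free_unit -kermx_eq0; apply/eqP/row_matrixP => i.
rewrite row0; apply: (grounded_kernel w0 dw).
by rewrite -row_mul mulmx_ker row0.
Qed.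

(** Summing the coordinates of the equation kills the Laplacian part and leaves [n * vsum y = 0]. *)
Lemma grounded_potential w x y : (0 < n)%N -> vsum x = 0 -> y *m grounded w = x
  ->
  vsum y = 0 /\ y *m laplacian w = x.
Proof.
move=> n0 x0 yx.
have y0 : vsum y = 0.
  have := congr1 (@vsum R n) yx.
  rewrite mul_grounded vsumD vsum_laplacian add0r x0 /vsum.
  rewrite (eq_bigr (fun=> vsum y)) ?sumr_const ?card_ord => [/eqP|i _];
    last by rewrite mxE.
  by rewrite mulrn_eq0 -leqn0 leqNgt n0 /= => /eqP.
by split=> //; move: yx; rewrite mul_grounded y0 => <-; apply/rowP => i;
  rewrite !mxE addr0.
Qed.

Definition inverse_of w (B : 'M[R]_n) := B^T = B /\ B *m grounded w = 1%:M.

Definition set_weight w e (a : R) : wvec R n := fun e' => if e' == e then a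
  else w e'.

Lemma energy_set_weight w e a x y : energy (set_weight w e a) x y = energy w x y
  + (a - w e) * ((x 0 (lo e) - x 0 (hi e)) * (y 0 (lo e) - y 0 (hi e))).
Proof.
rewrite /energy (bigD1 e) //= [in RHS](bigD1 e) //= /set_weight eqxx.
rewrite (eq_bigr (fun i => w i * ((x 0 (lo i) - x 0 (hi i)) * (y 0 (lo i) - y 0
  (hi i))))).
  by ring.
by move=> i /negbTE->.
Qed.

Lemma grounded_set_weight w e a : grounded (set_weight w e a) =
  grounded w + (a - w e) *: ((pair_vec R (hi e) (lo e))^T *m pair_vec R (hi e)
    (lo e)).
Proof.
rewrite /grounded [RHS]addrAC; congr (_ + _); apply/matrixP => u v.
rewrite -energy_delta energy_set_weight energy_delta !mxE big_ord1 !mxE.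
by rewrite !eqxx /= ![_ == u]eq_sym ![_ == v]eq_sym; ring.
Qed.

Lemma scalar_row_mul (x : 'rV[R]_n) (y : 'rV[R]_n) : x *m y^T = (dot x y)%:M.
Proof.
apply/matrixP => i j; rewrite !ord1 !mxE eqxx mulr1n.
by apply: eq_bigr => k _; rewrite mxE.
Qed.

Lemma inverse_set_weight w e (a : R) (B : 'M[R]_n) :
  w e = 1 -> nonneg_wvec (set_weight w e a) -> definite (set_weight w e a) ->
  inverse_of w B ->
  let u := hi e in let v := lo e in
  inverse_of (set_weight w e a) (\matrix_(i, j)
    (B i j - (a - 1) / (1 + (a - 1) * (B u u + B v v - B u v - B v u))
             * (B i u - B i v) * (B j u - B j v))).
Proof.
move=> we w'0 dw' [Bsym BM] u v.
have BC i j : B i j = B j i by rewrite -{1}Bsym mxE.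
pose X := pair_vec R u v; pose c := X *m B.
have cE i : c 0 i = B i u - B i v.
  by rewrite /c mulmxBl -!rowE !mxE BC (BC v).
pose den := 1 + (a - 1) * dot c X.
have denE : 1 + (a - 1) * (B u u + B v v - B u v - B v u) = den.
  by rewrite /den dot_pair !cE; ring.
have XX : dot X X = 2.
  by apply: dot_pair_pair; rewrite neq_ltn (valP e) orbT.
have cM' : c *m grounded (set_weight w e a) = den *: X.
  rewrite grounded_set_weight we -/u -/v -/X mulmxDr /c -mulmxA BM mulmx1 -/c.
  by rewrite -scalemxAr mulmxA scalar_row_mul mul_scalar_mx /den scalerDl
    scale1r scalerA.
(* By [cM'], a zero denominator would put [c] in the kernel of the updated matrix, which
   definiteness excludes. *)
have den0 : den != 0.
  apply/eqP => d0; rewrite d0 scale0r in cM'.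
  have c0 := grounded_kernel w'0 dw' cM'.
  have : X = 0 by rewrite -[X]mulmx1 -BM mulmxA -/c c0 mul0mx.
  move=> X0; have := XX; rewrite X0 -(scale0r 0) dotZl mul0r => /esym/eqP.
  by rewrite pnatr_eq0.
have cT : c^T = B *m X^T by rewrite /c trmx_mul Bsym.
rewrite denE; set g := (a - 1) / den.
clearbody c.
have -> : \matrix_(i, j) (B i j - g * (B i u - B i v) * (B j u - B j v)) =
    B - g *: (c^T *m c).
  by apply/matrixP => i j; rewrite !mxE big_ord1 !mxE !cE; ring.
split.
  by rewrite linearB /= linearZ /= trmx_mul trmxK Bsym.
rewrite mulmxBl -scalemxAl -mulmxA cM' grounded_set_weight we -/u -/v -/X.
rewrite mulmxDr BM -!scalemxAr mulmxA.
rewrite -cT scalerA /g divfK // -addrA subrr addr0 //.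
Qed.

Lemma inverse_init : (0 < n)%N -> inverse_of (fun=> 1) (n%:R^-1%:M).
Proof.
move=> n0; have nn0 : n%:R != 0 :> R by rewrite pnatr_eq0 -lt0n.
split; first by rewrite tr_scalar_mx.
have -> : grounded (fun=> 1) = n%:R%:M.
  apply/matrixP => u v; rewrite !mxE /wdegree.
  have E p q : edge_coord (fun=> 1 : R) p q = (p != q)%:R :> R.
    have [->|pq] := eqVneq p q; first by rewrite edge_coord_diag.
    by have [e [-> _]] := edge_coord_some (fun=> 1 : R) pq.
  rewrite E; have [->|uv] := eqVneq u v; last by rewrite !mulr0n sub0r addNr.
  rewrite !mulr1n subr0 (bigD1 v) //= E eqxx add0r.
  rewrite (eq_bigr (fun=> 1)) => [|p pv]; last by rewrite E eq_sym pv.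
  rewrite sumr_const (_ : #|_| = n.-1); last first.
    by rewrite -[in RHS](card_ord n) -(cardC1 v); apply: eq_card => p;
      rewrite !inE.
  by rewrite natr1 prednK.
by rewrite -scalar_mxM mulVf.
Qed.

End Inverse.

(** * Correctness of the incremental inverse *)

Section Estimate.
Variables (R : realType) (n : nat) (wt : nat -> nat -> R).

Definition wvec_of : wvec R n := fun e => wt (hi e) (lo e).

Hypotheses (n0 : (0 < n)%N) (wt0 : nonneg_wvec wvec_of) (dwt : definite
  wvec_of).

Let done_upto (u k : nat) (e : upair n) :=
  (hi e < u)%N || (hi e == u :> nat) && (lo e < k)%N.
Let part (u k : nat) : wvec R n :=
  fun e => if done_upto u k e then wvec_of e else 1.

Let part_ge0 u k : nonneg_wvec (part u k).
Proof. by move=> e; rewrite /part; case: ifP. Qed.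

(** The reason for starting from the complete graph: each intermediate weight is either final or 1,
    so no edge of the final graph is ever missing and no denominator vanishes. From the empty graph
    the first stages would be disconnected. *)
Let part_definite u k : definite (part u k).
Proof.
move=> x x0 /(energy_eq0 (part_ge0 u k)) H; apply: dwt => //.
apply: big1 => e _; have [->|we] := eqVneq (wvec_of e) 0;
  first by rewrite mul0r.
rewrite H ?subrr ?mul0r ?mulr0 // /part; case: ifP => // _; exact: oner_neq0.
Qed.

Let mx (F : nat -> nat -> R) : 'M[R]_n := \matrix_(i, j) F i j.

Let row_ok u k F : (u < n)%N -> (k <= u)%N -> inverse_of (part u 0) (mx F) ->
  inverse_of (part u k) (mx (row_update wt u k F)).
Proof.
move=> un + F0; elim: k => [//|k IH] ku.
have {}IH := IH (ltnW ku).
have kn : (k < n)%N := ltn_trans ku un.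
pose e : upair n := exist _ (Ordinal kn, Ordinal un) ku.
have pE : part u k.+1 = set_weight (part u k) e (wt u k).
  apply/funext => e'; rewrite /set_weight /part /done_upto.
  have [->|ne] := eqVneq e' e; first by rewrite /= eqxx ltnS leqnn orbT.
  congr (if _ then _ else _); congr (_ || _); case: eqP => //= hu.
  rewrite ltnS leq_eqVlt; case: eqP => //= lk.
  case/eqP: ne; apply: val_inj; rewrite [val e']surjective_pairing.
  by congr (_, _); apply: val_inj.
have pe1 : part u k e = 1 by rewrite /part /done_upto /= eqxx !ltnn.
have := @inverse_set_weight R n (part u k) e (wt u k) _ pe1.
rewrite -pE => /(_ _ (part_ge0 _ _) (@part_definite _ _) IH) Q.
move: Q; cbv zeta; set P := (X in inverse_of _ X) => Q.
have he : hi e = u :> nat by [].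
have le : lo e = k :> nat by [].
suff -> : mx (row_update wt u k.+1 F) = P by exact: Q.
by apply/matrixP => i j; rewrite /P !mxE he le.
Qed.

Lemma inverse_upto_ok : inverse_of wvec_of (\matrix_(i, j) inverse_upto wt n n
  i j).
Proof.
have H k : (k <= n)%N -> inverse_of (part k 0) (mx (inverse_upto wt n k)).
  elim: k => [_|k IH kn].
    have -> : part 0 0 = fun=> 1.
      by apply/funext => e; rewrite /part /done_upto ltn0 andbF.
    have -> : mx (inverse_upto wt n 0) = n%:R^-1%:M.
      apply/matrixP => i j; rewrite !mxE /= -val_eqE /= div1r.
      by case: eqP.
    exact: inverse_init.
  (* Row [k] has only the columns below [k], so finishing it is the same as not having begun row
     [k + 1]. *)
  rewrite (_ : part k.+1 0 = part k k); first exact: row_ok (IH (ltnW kn)).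
  apply/funext => e; rewrite /part /done_upto ltn0 andbF orbF ltnS leq_eqVlt
    orbC.
  congr (if _ || _ then _ else _); case: eqP => //= <-; exact/esym/(valP e).
rewrite (_ : wvec_of = part n 0); first exact: H.
by apply/funext => e; rewrite /part /done_upto ltn_ord.
Qed.

Lemma total_upto_ok : total_upto wt n = 2 * \sum_(e : upair n) wvec_of e.
Proof.
pose f (u v : 'I_n) := if (v < u)%N then wt u v + wt u v else 0.
transitivity (\sum_u \sum_v f u v).
  rewrite /total_upto big_mkord; apply: eq_bigr => u _; rewrite /row_total.
  rewrite (big_nat_widen _ _ n) ?(ltnW (ltn_ord u)) //= big_mkord big_mkcond /=.
  by apply: eq_bigr => v _.
rewrite sum_pairs => [|u]; last by rewrite /f ltnn.
rewrite mulr_sumr; apply: eq_bigr => e _; rewrite /f (valP e) ltnNge (ltnW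
  (valP e)) /= add0r.
by rewrite /wvec_of; ring.
Qed.

Lemma estimateE (u v : 'I_n) : u != v ->
  exists y : 'rV[R]_n, [/\ vsum y = 0, y *m laplacian wvec_of = pair_vec R u v &
    estimate wt n u v = 2 + 2 * (\sum_e wvec_of e) * dot y (pair_vec R u v)].
Proof.
move=> uv; have [Bs BM] := inverse_upto_ok; set B := \matrix_(_, _) _ in Bs BM.
have [] := @grounded_potential R n wvec_of (pair_vec R u v) (pair_vec R u v *m
  B) n0.
- exact: vsum_pair.
- by rewrite -mulmxA BM mulmx1.
move=> y0 yL; exists (pair_vec R u v *m B); split=> //.
rewrite /estimate total_upto_ok dot_pair mulmxBl -!rowE !mxE; ring.
Qed.

End Estimate.

(** * Hitting and commute times *)

Lemma eseries_eq (R : realType) (a : nat -> R) (l : R) :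
  (\sum_(0 <= t < N) a t @[N --> \oo] --> l) ->
  (\sum_(0 <= t <oo) (a t)%:E = l%:E)%E.
Proof.
move=> al; apply/cvg_lim => //; apply: cvg_EFin.
  by apply: nearW => N; rewrite sumEFin.
by under eq_fun do rewrite /= sumEFin.
Qed.

(** Split [rho ^ N] as [s ^ N * s ^ N] with [s] the square root: [(N + 1) * s ^ N] is below a
    partial geometric sum, hence bounded, and the other factor tends to 0. *)
Lemma cvg_natM_expr (R : realType) (a rho : R) : 0 <= rho < 1 ->
  (N.+1%:R * (a * rho ^+ N) @[N --> \oo] --> 0).
Proof.
move=> /andP[r0 r1]; set s := Num.sqrt rho.
have s0 : 0 <= s by exact: sqrtr_ge0.
have s1 : s < 1 by rewrite -sqrtr1 ltr_sqrt.
have bound N : N.+1%:R * s ^+ N <= (1 - s)^-1.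
  have : N.+1%:R * s ^+ N <= \sum_(i < N.+1) s ^+ i.
    rewrite -[X in X%:R](card_ord N.+1) mulr_natl -sumr_const;
      apply: ler_sum => i _.
    by apply: ler_wiXn2l; [|exact: ltW|rewrite -ltnS].
  move=> /le_trans; apply.
  have E := subrX1 s N.+1.
  rewrite -[leRHS]mul1r ler_pdivlMr ?subr_gt0 //.
  have : 0 <= s ^+ N.+1 by rewrite exprn_ge0.
  lra.
have -> : (fun N => N.+1%:R * (a * rho ^+ N)) = (fun N => (N.+1%:R * s ^+ N) *
  (a * s ^+ N)).
  by apply/funext => N; rewrite -{1}(sqr_sqrtr r0) -/s -exprM mulnC exprM
    expr2; ring.
have g0 : (`|a| / (1 - s) * s ^+ N @[N --> \oo] --> 0).
  by apply: cvg_geometric; rewrite ger0_norm.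
apply: (squeeze_cvgr _ _ g0); last by rewrite -oppr0; exact: cvgN g0.
apply: nearW => N; rewrite -ler_norml !normrM !(ger0_norm (exprn_ge0 _ s0)).
rewrite (ger0_norm (ler0n _ _)) mulrA [`|a| / _]mulrC ler_wpM2r ?exprn_ge0 //.
by rewrite ler_wpM2r.
Qed.

Section Walk.
Variables (R : realType) (n : nat) (w : wvec R n).
Hypotheses (w0 : nonneg_wvec w) (deg0 : forall u, 0 < wdegree w u).
Implicit Types (u v x : 'I_n) (t N : nat).

Lemma walk_step_ge0 u x : 0 <= walk_step w u x.
Proof. by rewrite divr_ge0 ?edge_coord_ge0 // ltW. Qed.

Lemma sum_walk_step u : \sum_x walk_step w u x = 1.
Proof. by rewrite -mulr_suml -/(wdegree w u) divff // gt_eqF. Qed.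

Lemma hit_prob0 u v : hit_prob w u v 0 = 0.
Proof. by rewrite /hit_prob big_pred0 // => x; rewrite tuple0. Qed.

Lemma big_tuple_cons t (P : pred (seq 'I_n)) (F : seq 'I_n -> R) :
  \sum_(x : t.+1.-tuple 'I_n | P x) F x =
  \sum_x \sum_(y : t.-tuple 'I_n | P (x :: y)) F (x :: y).
Proof.
rewrite pair_big_dep /=.
rewrite (reindex (fun p : 'I_n * t.-tuple 'I_n => cons_tuple p.1 p.2)) /=;
  last first.
  exists (fun y : t.+1.-tuple 'I_n => (thead y, behead_tuple y)).
    by move=> [x y] _ /=; congr (_, _); apply: val_inj.
  by move=> y _; rewrite [in RHS](tuple_eta y); apply: val_inj.
by [].
Qed.

Lemma hit_prob1 u v : hit_prob w u v 1 = (u == v)%:R.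
Proof.
rewrite /hit_prob (@big_tuple_cons 0 (fun s => (ohead s == Some u) && (index v
  s == 0))
   (fun s => \prod_(e <- zip s (behead s)) walk_step w e.1 e.2)) (bigD1 u) //=.
rewrite [X in _ + X]big1 ?addr0 => [|x xu]; last first.
  by rewrite big_pred0 // => y; rewrite (inj_eq Some_inj) (negbTE xu).
rewrite eqxx /=; case: eqVneq => [->|uv].
  rewrite (eq_bigl predT) => [|y]; last by rewrite eqxx.
  rewrite (eq_bigr (fun=> 1)) => [|y _]; last by rewrite tuple0 big_nil.
  by rewrite sumr_const card_tuple.
by rewrite big_pred0 // => y; rewrite (negbTE uv).
Qed.

(** Conditioning on the second position of the walk. A walk starting at [v] has hit at time 1, hence
    the value 0. *)
Lemma hit_probS u v t : hit_prob w u v t.+2 =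
  if u == v then 0 else \sum_x walk_step w u x * hit_prob w x v t.+1.
Proof.
rewrite /hit_prob (@big_tuple_cons t.+1 (fun s => (ohead s == Some u) && (index
  v s == t.+1))
   (fun s => \prod_(e <- zip s (behead s)) walk_step w e.1 e.2)) (bigD1 u) //=.
rewrite [X in _ + X]big1 ?addr0 => [|x xu]; last first.
  by rewrite big_pred0 // => y; rewrite (inj_eq Some_inj) (negbTE xu).
rewrite eqxx /=; case: eqVneq => [->|uv]; first by rewrite big_pred0 // => y;
  rewrite eqxx.
rewrite (eq_bigl (fun y : t.+1.-tuple 'I_n => index v y == t)) => [|y];
  last first.
  by rewrite eqSS.
rewrite (partition_big (fun y : t.+1.-tuple 'I_n => thead y) predT) //=.
apply: eq_bigr => x _; rewrite mulr_sumr; apply: eq_big => y.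
  by case/tupleP: y => z y; rewrite theadE andbC (inj_eq Some_inj).
by case/tupleP: y => z y; rewrite theadE => /andP[_ /eqP <-];
  rewrite /= big_cons.
Qed.

Section Target.
Variables (v : 'I_n) (H : 'I_n -> R).
Hypotheses (Hv : H v = 1)
  (Hstep : forall u, u != v -> H u = 1 + \sum_x walk_step w u x * H x).

(** The transition operator of the walk killed at [v]. *)
Let Q (f : 'I_n -> R) u : R := if u == v then 0 else \sum_x walk_step w u x * f
  x.
Let survival t u := 1 - \sum_(0 <= s < t.+1) hit_prob w u v s.

Let survivalE t u : survival t u = iter t Q (fun=> 1) u.
Proof.
elim: t u => [|t IH] u.
  by rewrite /survival big_nat1 hit_prob0 subr0.
rewrite /survival big_nat_recl // hit_prob0 add0r big_nat_recl // hit_prob1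
  iterS /Q.
have -> : \sum_(0 <= i < t) hit_prob w u v i.+2 =
    if u == v then 0 else \sum_x walk_step w u x * \sum_(0 <= i < t) hit_prob w
      x v i.+1.
  rewrite (eq_bigr _ (fun i _ => hit_probS u v i)); case: eqP => _;
    first by rewrite big1.
  by rewrite exchange_big; apply: eq_bigr => x _; rewrite mulr_sumr.
case: eqVneq => uv; first by rewrite addr0 subrr.
rewrite add0r -{1}(sum_walk_step u) -sumrB; apply: eq_bigr => x _.
by rewrite -IH /survival big_nat_recl // hit_prob0 add0r mulrBr mulr1.
Qed.

Let Q_ge0 f : (forall u, 0 <= f u) -> forall u, 0 <= Q f u.
Proof.
move=> f0 u; rewrite /Q; case: ifP => // _.
by apply: sumr_ge0 => x _; rewrite mulr_ge0 ?walk_step_ge0.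
Qed.

Let Q_le f g : (forall u, f u <= g u) -> forall u, Q f u <= Q g u.
Proof.
move=> fg u; rewrite /Q; case: ifP => // _.
by apply: ler_sum => x _; rewrite ler_wpM2l ?walk_step_ge0.
Qed.

Let QH u : H u = 1 + Q H u.
Proof. by rewrite /Q; case: eqVneq => [->|/Hstep//]; rewrite Hv addr0. Qed.

(* At a minimiser [x != v] the equation would give [H x >= 1 + H x]. *)
Let H_ge1 u : 1 <= H u.
Proof.
pose x := [arg min_(x < v) H x]%O.
have xmin y : H x <= H y by rewrite /x; case: arg_minP => // z _; exact.
apply: le_trans (xmin u); rewrite QH lerDl /Q; case: eqVneq => // xv.
have : H x >= 1 + H x * 1.
  rewrite [leRHS]Hstep // lerD2l -(sum_walk_step x) mulr_sumr;
    apply: ler_sum => y _.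
  by rewrite mulrC ler_wpM2l ?walk_step_ge0.
by rewrite mulr1 gerDr leNgt ltr01.
Qed.

Let Mx := \sum_u H u.
Let rho := 1 - Mx^-1.

Let H_le u : H u <= Mx.
Proof.
rewrite /Mx (bigD1 u) //= lerDl; apply: sumr_ge0 => x _;
  exact: le_trans ler01 (H_ge1 x).
Qed.

Let Mx1 : 1 <= Mx. Proof. exact: le_trans (H_ge1 v) (H_le v). Qed.

Let rho01 : 0 <= rho < 1.
Proof.
have M0 : 0 < Mx by exact: lt_le_trans ltr01 Mx1.
by rewrite /rho subr_ge0 invf_le1 // Mx1 /= gtrBl invr_gt0.
Qed.

(** [Q H = H - 1], and [H <= Mx] gives [1 >= H / Mx], so each step contracts [H] by the factor
    [rho]. *)
Let iterQ_H t u : iter t Q H u <= rho ^+ t * H u.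
Proof.
have M0 : 0 < Mx by exact: lt_le_trans ltr01 Mx1.
elim: t u => [|t IH] u; first by rewrite mul1r.
rewrite iterS; apply: le_trans (Q_le IH u) _.
have -> : Q (fun u => rho ^+ t * H u) u = rho ^+ t * Q H u.
  rewrite /Q; case: ifP => _; first by rewrite mulr0.
  by rewrite mulr_sumr; apply: eq_bigr => x _; rewrite mulrCA.
rewrite exprSr -mulrA ler_wpM2l ?exprn_ge0 //; first by case/andP: rho01.
have -> : Q H u = H u - 1 by rewrite [in RHS]QH; ring.
by rewrite /rho mulrBl mul1r lerB // mulrC ler_pdivrMr // mul1r.
Qed.

Let survival_bounds t u : 0 <= survival t u <= iter t Q H u.
Proof.
rewrite survivalE; elim: t u => [|t IH] u /=; first by rewrite ler01 H_ge1.
rewrite Q_ge0 => [|x]; last by case/andP: (IH x).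
by apply: Q_le => x; case/andP: (IH x).
Qed.

(** Telescoping: applying the [N]th iterate of the linear [Q] to [H = 1 + Q H] writes the survival
    probability as a difference of consecutive iterates on [H]. *)
Let sum_survival N u : \sum_(0 <= t < N) survival t u = H u - iter N Q H u.
Proof.
elim: N u => [|N IH] u; first by rewrite big_geq // subrr.
rewrite big_nat_recr //= IH survivalE.
suff -> : iter N Q H u = iter N Q (fun=> 1) u + Q (iter N Q H) u by ring.
elim: N u {IH} => [|N IH] u /=; first exact: QH.
transitivity (Q (fun x => iter N Q (fun=> 1) x + Q (iter N Q H) x) u).
  by congr (Q _ u); apply/funext.
rewrite [LHS]/Q [X in _ = X + _]/Q [X in _ = _ + X]/Q; case: eqP => _;
  first by rewrite addr0.
by rewrite -big_split; apply: eq_bigr => x _; rewrite /= mulrDr.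
Qed.

Let sum_hit N u : \sum_(0 <= t < N.+1) t%:R * hit_prob w u v t =
  H u - (iter N Q H u + N%:R * survival N u).
Proof.
rewrite opprD addrA -sum_survival.
elim: N => [|N IH]; first by rewrite big_nat1 big_geq // !mul0r subrr.
rewrite big_nat_recr //= IH [in RHS]big_nat_recr //=.
have -> : hit_prob w u v N.+1 = survival N u - survival N.+1 u.
  by rewrite /survival [in X in _ - X]big_nat_recr //=; ring.
by rewrite -natr1; ring.
Qed.

Let err u N := N.+1%:R * (H u * rho ^+ N).

Let errP u N : 0 <= iter N Q H u + N%:R * survival N u <= err u N.
Proof.
have /andP[s0 s1] := survival_bounds N u.
apply/andP; split; first by rewrite addr_ge0 ?mulr_ge0 // (le_trans s0).
rewrite /err -natr1 mulrDl mul1r addrC.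
have QN : iter N Q H u <= H u * rho ^+ N by rewrite mulrC; exact: iterQ_H.
by rewrite lerD // ler_wpM2l // (le_trans s1).
Qed.

(** Any solution of the first-step equations is the hitting time: summation by parts leaves an error
    dominated by [err], a linear factor times a geometric one. *)
Lemma hitting_time_eq u : hitting_time w u v = (H u)%:E.
Proof.
have e0 : err u N @[N --> \oo] --> 0 by exact: cvg_natM_expr.
have lim_sub (f : nat -> R) (l : R) : (forall N, 0 <= f N <= err u N) ->
    l - f N @[N --> \oo] --> l.
  move=> f0; have fz : f N @[N --> \oo] --> 0.
    by apply: (squeeze_cvgr _ _ e0); [apply: nearW|exact: cvg_cst].
  have : (fun N => l - f N) @ \oo --> l - 0 by apply: cvgB => //;
    exact: cvg_cst.
  by rewrite subr0.
have l1 : \sum_(0 <= t < N) t%:R * hit_prob w u v t @[N --> \oo] --> H u.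
  rewrite -cvg_shiftS /=; under eq_fun do rewrite sum_hit.
  exact: lim_sub (errP u).
have l2 : \sum_(0 <= t < N) hit_prob w u v t @[N --> \oo] --> (1 : R).
  rewrite -cvg_shiftS /=.
  have E N : \sum_(0 <= t < N.+1) hit_prob w u v t = 1 - survival N u.
    by rewrite /survival; ring.
  under eq_fun do rewrite E.
  apply: lim_sub => N; have /andP[s0 s1] := survival_bounds N u.
  have /andP[_] := errP u N; rewrite s0 /=; apply: le_trans;
    apply: le_trans s1 _.
  by rewrite lerDl mulr_ge0.
(* The target is hit almost surely, so the infinite term is multiplied by 0. *)
rewrite /hitting_time (eseries_eq l1) (eseries_eq l2).
by rewrite -EFinB subrr mule0 adde0.
Qed.

End Target.

End Walk.

(** * Commute time through effective resistance *)

Section Commute.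
Variables (R : realType) (n : nat) (w : wvec R n).
Hypotheses (n1 : (1 < n)%N) (w0 : nonneg_wvec w) (cw : connected_graph w).

Lemma wdegree_gt0 (u : 'I_n) : 0 < wdegree w u.
Proof.
have [l0 ray] := lambda_rayleigh n1 w0 (connected_definite w0 cw).
rewrite lt_neqAle sumr_ge0 ?andbT => [|v _]; last exact: edge_coord_ge0.
apply/eqP => d0.
have c0 v : edge_coord w u v = 0.
  have /eqP := esym d0; rewrite psumr_eq0 => [/allP/(_ v (mem_index_enum
    v))/eqP//|x _].
  exact: edge_coord_ge0.
have [v uv] : exists v : 'I_n, u != v.
  have [u0|u0] := eqVneq (val u) 0%N.
    by exists (Ordinal n1); rewrite -val_eqE /= u0.
  by exists (Ordinal (ltnW n1)).
have /connectP[[|x p] /=] := cw u v; first by move=> _ E; rewrite E eqxx in uv.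
by rewrite /adj c0 eqxx.
Qed.

Lemma commute_timeE (u v : 'I_n) : u != v ->
  exists y : 'rV[R]_n, [/\ vsum y = 0, y *m laplacian w = pair_vec R u v &
    commute_time w u v = (2 + 2 * (\sum_e w e) * dot y (pair_vec R u v))%:E].
Proof.
move=> uv.
have n0 : (0 < n)%N := ltnW n1.
have dw := connected_definite w0 cw.
have gu := grounded_unit w0 dw.
pose B := invmx (grounded w).
have BM : B *m grounded w = 1%:M by rewrite mulVmx.
pose D := \sum_x wdegree w x.
pose d : 'rV[R]_n := \row_x wdegree w x.
have vd : vsum d = D by apply: eq_bigr => x _; rewrite mxE.
(* Away from [t], the Laplace equation with the degrees as right-hand side is the first-step
   equation; the mass [- D] at [t] makes the right-hand side sum to zero, hence solvable. *)
pose g (t : 'I_n) : 'rV[R]_n := (d + (- D) *: delta_mx 0 t) *m B.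
have gP t : g t *m laplacian w = d + (- D) *: delta_mx 0 t.
  have [] // := @grounded_potential R n w (d + (- D) *: delta_mx 0 t) (g t) n0.
  - by rewrite vsumD vsumZ vsum_delta vd mulr1 subrr.
  - by rewrite /g -mulmxA BM mulmx1.
have gE t x : g t 0 x = (d *m B) 0 x - D * (delta_mx 0 t *m B : 'rV[R]_n) 0 x.
  by rewrite /g mulmxDl -scalemxAl mxE [X in _ + X]mxE mulNr.
clearbody g.
pose H t x := 1 + (g t 0 x - g t 0 t).
have hit t s : hitting_time w s t = (H t s)%:E.
  apply: (hitting_time_eq w0 wdegree_gt0); first by rewrite /H subrr addr0.
  move=> x xt.
  have dx := wdegree_gt0 x.
  have E : wdegree w x * g t 0 x - \sum_y edge_coord w x y * g t 0 y = wdegree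
    w x.
    have E0 : (g t *m laplacian w) 0 x = wdegree w x.
      by rewrite gP !mxE (negbTE xt) andbF mulr0 addr0.
    rewrite -[RHS]E0 /laplacian mulmxBr mul_mx_diag !mxE mulrC; congr (_ - _).
    by apply: eq_bigr => y _; rewrite mxE edge_coordC mulrC.
  have -> : \sum_y walk_step w x y * H t y =
      (1 - g t 0 t) + (\sum_y edge_coord w x y * g t 0 y) / wdegree w x.
    set k := 1 - g t 0 t; rewrite -[X in X + _]mulr1 -(sum_walk_step
      wdegree_gt0 x) mulr_sumr mulr_suml -big_split.
    by apply: eq_bigr => y _; rewrite /H /walk_step /k /=; ring.
  have -> : \sum_y edge_coord w x y * g t 0 y = wdegree w x * (g t 0 x - 1).
    by rewrite mulrBr mulr1 -{2}E; ring.
  by rewrite mulrAC divff ?gt_eqF // mul1r /H; ring.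
have [] := @grounded_potential R n w (pair_vec R u v) (pair_vec R u v *m B) n0.
- exact: vsum_pair.
- by rewrite -mulmxA BM mulmx1.
move=> y0 yL; exists (pair_vec R u v *m B); split=> //.
(* The contribution of [d] cancels between the two directions; what remains is [D] times the
   effective resistance, and [D] is twice the total weight. *)
rewrite /commute_time !hit -EFinD; congr EFin.
rewrite -sum_wdegree -/D dot_pair /H.
have -> : pair_vec R u v *m B = delta_mx 0 u *m B - delta_mx 0 v *m B by
  rewrite mulmxBl.
rewrite !gE ![(_ - _ : 'rV[R]_n) _ _]mxE ![(- _ : 'rV[R]_n) _ _]mxE.
ring.
Qed.

End Commute.

(** * Logistic noise *)

Section Logistic.
Variable R : realType.

Lemma logit_odds_shift (t x : R) : 0 < t -> 0 < x < 1 ->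
  logit (odds_shift t x) = logit x + ln t.
Proof.
move=> t0 /andP[x0 x1]; rewrite /logit /odds_shift.
have d0 : 0 < 1 - x + x * t by rewrite addr_gt0 ?subr_gt0 ?mulr_gt0.
have y0 : 0 < x / (1 - x) by rewrite divr_gt0 ?subr_gt0.
rewrite -lnM ?posrE //; congr ln.
have -> : 1 - x * t / (1 - x + x * t) = (1 - x) / (1 - x + x * t).
  by field; rewrite gt_eqF.
by field; rewrite !gt_eqF ?subr_gt0.
Qed.

(** The two end points are those with odds [1 / q] and [q]. *)
Lemma logit_bound (q x : R) : 0 < q -> (1 + q)^-1 <= x -> x <= 1 - (1 + q)^-1 ->
  `|logit x| <= ln q.
Proof.
move=> q0 dx xd.
have q1 : 0 < 1 + q by rewrite addr_gt0.
have x0 : 0 < x by apply: lt_le_trans dx; rewrite invr_gt0.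
have i0 : 0 < (1 + q)^-1 by rewrite invr_gt0.
have x1 : 0 < 1 - x by lra.
have E : 1 - (1 + q)^-1 = q * (1 + q)^-1 by field; rewrite gt_eqF.
have h1 : x / (1 - x) <= q.
  rewrite ler_pdivrMr //; rewrite E in xd.
  have : 1 - x >= (1 + q)^-1 by rewrite -E in xd; lra.
  by move=> h; apply: le_trans xd _; rewrite ler_wpM2l // ltW.
have h2 : q^-1 <= x / (1 - x).
  rewrite ler_pdivlMr // mulrC ler_pdivrMr //.
  rewrite mulrC; apply: le_trans (_ : q * (1 + q)^-1 <= _); first by lra.
  by rewrite ler_wpM2l // ltW.
rewrite ler_norml /logit -lnV ?posrE // !ler_ln ?posrE ?invr_gt0 ?divr_gt0 //.
by rewrite h1 h2.
Qed.

End Logistic.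

(** * Thresholding the noisy weights *)

Section Sanitize.
Variables (R : realType) (tau n0 : nat).

Lemma keep_indE (n : nat) (y : R) :
  keep_ind n0 n y = if (n < n0)%N || (0 < y) then 1 else 0.
Proof.
rewrite /keep_ind; case: ltnP => [nn|nn] /=.
  by rewrite divff ?subrr ?mul0r ?subr0 // pnatr_eq0 subn_eq0 -ltnNge.
rewrite (eqP nn) mul0r subr0 mul1r; case: ltP => y0; last first.
  by rewrite !ln0 ?mul0r ?subr0 ?mulr1 ?subrr // -(addr0 0) lerD.
(* The only positive number with zero logarithm is 1; there the factor in [y + y] takes over, as
   [ln 2] is nonzero. *)
have [l0|l0] := eqVneq (ln y) 0; last by rewrite divff // subrr mul0r subr0.
have y1 : y = 1 by apply/eqP; rewrite -ln_eq0 // l0.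
have l2 : ln (1 + 1) != 0 :> R.
  by rewrite ln_eq0 ?addr_gt0 // -subr_eq0 addrK oner_eq0.
by rewrite y1 [ln (1 + 1) / _]divff // subrr mulr0 subr0.
Qed.

(** A kept weight changes by [N + T], between 0 and [2 * T]. For large [n], a dropped one was at
    most [T - N], and a kept one was positive, so the support does not grow. *)
Lemma sanitize_spec (n : nat) (eps w N : R) :
  0 <= w -> 0 < threshold tau n eps -> `|N| <= threshold tau n eps ->
  let T := threshold tau n eps in let w' := sanitize tau n0 n eps (w + N) in
  [/\ 0 <= w', (n < n0)%N -> w <= w' &
      `|w' - w| <= if (n < n0)%N || (w != 0) then 2 * T else 0].
Proof.
move=> w0 T0 NT /=; rewrite /sanitize keep_indE;
  set T := threshold _ _ _ in T0 NT *.
have /andP[N1 N2] : - T <= N <= T by rewrite -ler_norml.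
case: ltnP => [nn|nn] /=.
  rewrite mulr1; split; [lra|lra|].
  by rewrite ger0_norm; lra.
case: ltP => y0.
  rewrite mulr1; split=> //; first lra.
  have wn0 : w != 0 by apply/eqP => E; rewrite E in y0; lra.
  by rewrite wn0 ger0_norm; lra.
rewrite mulr0; split=> //; rewrite sub0r normrN ger0_norm //.
case: eqP => [->//|_ /=]; lra.
Qed.

End Sanitize.

(** * Privacy *)

Section Privacy.
Variables (R : realType) (tau n0 : nat).
Local Notation RR := (measurableTypeR R).

Lemma uniform01_boundary : uniform01 R (~` `]0, 1[%classic) = 0%E.
Proof.
rewrite uniform01E; last by apply: measurableC.
rewrite setIC -setDE measureD //=; last by rewrite lebesgue_measure_itv /=
  lte_fin ltr01 ltry.
rewrite setIidr; last by apply: subset_itvW.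
by rewrite !lebesgue_measure_itv /= !lte_fin ltr01 -EFinD subrr.
Qed.

Lemma weight_at_lt (n : nat) (w : wvec R n) a b (ba : (b < a)%N) (an : (a <
  n)%N) :
  weight_at w a b = w (exist _ (Ordinal (ltn_trans ba an), Ordinal an) ba).
Proof.
rewrite -[in RHS]edge_coordE' -weight_atE //.
Qed.

(** The coupling behind privacy: the difference between the two inputs is carried over to the single
    variate of the differing edge. *)
Lemma estimate_shift (n T : nat) (eps t : R) (w w' : wvec R n) (e0 : upair n)
    (tape : T.-tuple RR) (i j : nat) :
  0 < t -> (n * n <= T)%N -> (forall e, e != e0 -> w e = w' e) ->
  w' e0 + ln t / eps = w e0 -> 
  0 < nth 0 tape (hi e0 * n + lo e0) < 1 ->
  estimate (fun a b => sanitize tau n0 n eps (noisy_weight eps w tape a b)) n i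
    j =
  estimate (fun a b => sanitize tau n0 n eps (noisy_weight eps w'
    (map_coord (hi e0 * n + lo e0) (odds_shift t) tape) a b)) n i j.
Proof.
move=> t0 nT ww' w0 x01; apply: estimate_ext => a b ba an; congr sanitize.
have bn := ltn_trans ba an.
rewrite /noisy_weight !(weight_at_lt _ ba an); set e := exist _ _ _.
rewrite nth_map_coord; last by rewrite (leq_trans _ nT) // pair_index_lt.
have [ee|ne] := eqVneq e e0.
  move: w0 x01; rewrite -ee /= eqxx => <- x01.
  by rewrite logit_odds_shift //; ring.
rewrite ifF; first by rewrite ww'.
apply/eqP => E; case/eqP: ne; have [E1 E2] := pair_index_inj bn (ltn_ord _) E.
apply: val_inj; rewrite [val e0]surjective_pairing.
by congr (_, _); apply: val_inj.
Qed.

Lemma program_private (n : nat) (eps : R) : 0 < eps ->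
  differentially_private (tape_law R time_poly.[n]) eps 0
    (@output R (program tau n0) time_poly.[n] n eps).
Proof.
move=> eps0 w w' w_ge0 w'_ge0 [l0 linf] S mS; set T := time_poly.[n].
have nT : (time_bound n <= T)%N by rewrite /T time_polyE.
have nnT : (n * n <= T)%N.
  by apply: leq_trans nT; rewrite /time_bound; lia.
rewrite adde0; have P0 A : (0 <= tape_law R T A)%E by exact: measure_ge0.
have mM v : nonneg_wvec v -> @measurable _ (T.-tuple RR) (@output R (program
  tau n0) T n eps v @^-1` S).
  by move=> v0; exact: (@oblivious_measurable R T _ n eps (program_oblivious
    tau n0) v v0 S mS).
case: (pickP (fun e => w e != w' e)) => [e0 ne0|same]; last first.
  have -> : w = w' by apply/funext => e; apply/eqP/negPn; rewrite same.
  rewrite -[leLHS]mul1e lee_wpmul2r // lee_fin -expR0 ler_expR; exact: ltW.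
have others e : e != e0 -> w e = w' e.
  move=> ee0; apply/eqP/negPn/negP => ne.
  have : (2 <= norm0 (fun e => w e - w' e : R)%R)%N.
    rewrite /norm0 (cardD1 e0) (cardD1 e) !inE ee0 !subr_eq0 ne0 ne; lia.
  by lia.
(* This shift of the logit moves the noise by exactly [w e0 - w' e0]; since [s] is at most [eps] in
   absolute value, [C = expR eps] meets both conditions of [uniform01_odds_shift]. *)
pose s := eps * (w e0 - w' e0); pose t := expR s.
have s1 : `|s| <= eps.
  by rewrite /s normrM gtr0_norm // -[leRHS]mulr1 ler_pM2l // linf.
have /andP[s1a s1b] : - eps <= s <= eps by rewrite -ler_norml.
have t0 : 0 < t by exact: expR_gt0.
pose k := (hi e0 * n + lo e0)%N.
have kT : (k < T)%N by rewrite (leq_trans _ nnT) // pair_index_lt.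
pose Bad := [set tape : T.-tuple RR | (~` `]0, 1[%classic) (nth 0 tape k)].
have mBad : measurable Bad.
  have mC : @measurable _ RR (~` `]0, 1[%classic) by apply: measurableC.
  by have := @measurable_nth_tuple R T k measurableT _ mC; rewrite setTI.
have Bad0 : tape_law R T Bad = 0%E.
  rewrite -uniform01_boundary; apply: tape_law_coord => //; exact: measurableC.
pose A' := @output R (program tau n0) T n eps w' @^-1` S.
have mA' : measurable A' by exact: mM.
pose Phi := @map_coord R T k (odds_shift t).
have mPhi : measurable (Phi @^-1` A').
  rewrite -[_ @^-1` _]setTI.
  exact: (measurable_map_coord k (@measurable_odds_shift R t) measurableT mA').
apply: (@le_trans _ _ (tape_law R T (Phi @^-1` A' `|` Bad))).
  apply: le_measure; rewrite ?inE //; [exact: mM|exact: measurableU|].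
  move=> tape Stape; have [x01|x01] := boolP (0 < nth 0 tape k < 1); last first.
    by right; rewrite /Bad /= in_itv /=; exact/negP.
  left; rewrite /Phi /A' /=; suff <- : output (program tau n0) eps w tape =
    output (program tau n0) eps w' (map_coord k (odds_shift t) tape) by [].
  apply/funext => e; rewrite /output.
  have [_ ->] := @run_program R tau n0 n T eps w tape nT; rewrite ?ltn_ord //.
  have [_ ->] := @run_program R tau n0 n T eps w' (map_coord k (odds_shift t)
    tape) nT; rewrite ?ltn_ord //.
  apply: estimate_shift => //.
  by rewrite /t expRK /s; field; rewrite gt_eqF.
apply: le_trans (measureU2 _ mPhi mBad) _.
rewrite [X in (_ + X)%E]Bad0 adde0.
apply: (@tape_law_map_coord R (odds_shift t) (expR eps) (expR_ge0 _)
  (@measurable_odds_shift R t) _ T k A' kT mA').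
apply: uniform01_odds_shift => //; first by rewrite ler_expR.
by rewrite -expRD -expR0 ler_expR; lra.
Qed.

End Privacy.

(** * Accuracy *)

Section Accuracy.
Variables (R : realType) (tau n0 : nat).
Hypothesis (n0P : expR (4 * tau%:R) <= n0%:R :> R).
Local Notation RR := (measurableTypeR R).

(** 36 is the constant of [commute_perturbation]; the bracket bounds [beta / Gam]. Its second term
    is for [n < n0], where [beta <= 2 * T * n0] and [Gam >= ln 2 * ln n / eps]. *)
Definition accuracy_cst : R := 36 * (1 + 2 * tau%:R * n0%:R / ln 2).

Lemma accuracy_cst_gt0 : 0 < accuracy_cst.
Proof.
rewrite /accuracy_cst mulr_gt0 // ltr_pwDl // divr_ge0 ?mulr_ge0 // ltW //
  ln_gt0 //.
by rewrite ltr1n.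
Qed.

Lemma degree_le n (w : wvec R n) u : (#|adj w u| <= max_degree w)%N.
Proof.
rewrite /max_degree (bigD1 u) //= (leq_trans _ (leq_maxl _ _)) //.
Qed.

Section OnGoodTapes.
Variables (n : nat) (eps : R) (w : wvec R n) (tape : seq R).
Hypotheses (eps0 : 0 < eps) (n1 : (1 < n)%N) (w0 : nonneg_wvec w)
  (cw : connected_graph w) (tau0 : (0 < tau)%N).
Let Gam : R := (max_degree w)%:R * ln n%:R ^+ 2 / eps.
Hypothesis (gap : (max_degree w)%:R * ln n%:R ^+ 2 / (eps * lambda w) < 1 / 2).
Hypothesis (good : forall i, (i < n * n)%N ->
  (1 + n%:R ^+ tau)^-1 <= tape`_i <= 1 - (1 + n%:R ^+ tau)^-1).

Let T := threshold tau n eps.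
Let wt a b := sanitize tau n0 n eps (noisy_weight eps w tape a b).
Let wt' : wvec R n := wvec_of wt.
Let b : wvec R n := fun e => if (n < n0)%N || (w e != 0) then 2 * T else 0.
Let beta : R := 2 * T * (if (n < n0)%N then n else max_degree w)%:R.

Let ln0 : 0 < ln n%:R :> R. Proof. by rewrite ln_gt0 // ltr1n. Qed.

Let T0 : 0 < T.
Proof. by rewrite /T /threshold mulr_gt0 ?ltr0n // divr_gt0. Qed.

Let noise (e : upair n) : `|logit tape`_(hi e * n + lo e) / eps| <= T.
Proof.
rewrite normrM (gtr0_norm (_ : 0 < eps^-1)) ?invr_gt0 // /T /threshold mulrA
  ler_pM2r ?invr_gt0 //.
rewrite mulr_natl -lnXn ?ltr0n ?(ltnW n1) //.
have /andP[g1 g2] := good (pair_index_lt (ltn_ord (hi e)) (ltn_ord (lo e))).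
by apply: logit_bound => //; rewrite exprn_gt0 // ltr0n ltnW.
Qed.

Let wt'E e : wt' e = sanitize tau n0 n eps (w e + logit tape`_(hi e * n + lo e)
  / eps).
Proof. by rewrite /wt' /wvec_of /wt /noisy_weight weight_atE edge_coordE'. Qed.

Let wt'_ge0 : nonneg_wvec wt'.
Proof. by move=> e; rewrite wt'E; have [] := sanitize_spec n0 (w0 e) T0 (noise
  e). Qed.

Let wt'_ge : (n < n0)%N -> forall e, w e <= wt' e.
Proof. by move=> nn e; rewrite wt'E; have [_ + _] := sanitize_spec n0 (w0 e) T0
  (noise e); apply. Qed.

Let wt'_close e : `|wt' e - w e| <= b e.
Proof. by rewrite wt'E; have [_ _] := sanitize_spec n0 (w0 e) T0 (noise e). Qed.

Let b_degree u : wdegree b u <= beta.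
Proof.
rewrite /beta /wdegree; case: ifP => nn.
  rewrite mulr_natr -[X in _ *+ X](card_ord n) -sumr_const;
    apply: ler_sum => v _.
  have [->|uv] := eqVneq u v; first by rewrite edge_coord_diag mulr_ge0 // ltW.
  by have [e [-> _]] := edge_coord_some b uv; rewrite /b nn.
rewrite (eq_bigr (fun v => if adj w u v then 2 * T else 0)) => [|v _].
  rewrite -big_mkcond sumr_const mulr_natr ler_wpMn2l //;
    [by rewrite mulr_ge0 // ltW|exact: degree_le].
rewrite /adj; have [->|uv] := eqVneq u v; first by rewrite !edge_coord_diag
  eqxx.
have [e [_ [[-> ->]|[-> ->]]]] := edge_coord_some b uv.
  by rewrite !edge_coordE /b nn.
by rewrite !edge_coordE' /b nn.
Qed.

Let dw := connected_definite w0 cw.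

Let lambda0 : 0 < lambda w. Proof. by have [] := lambda_rayleigh n1 w0 dw. Qed.

Let ray x : vsum x = 0 -> lambda w * dot x x <= energy w x x.
Proof. by have [_] := lambda_rayleigh n1 w0 dw; apply. Qed.

Let Delta1 : (1 <= max_degree w)%N.
Proof.
have u : 'I_n := Ordinal n1.
have := wdegree_gt0 n1 w0 cw u; rewrite lt_neqAle eq_sym => /andP[d0 _].
have [v av] : exists v, adj w u v.
  apply/existsP; apply: contraR d0; rewrite negb_exists => /forallP H.
  by apply/eqP/big1 => v _; apply/eqP/negPn/H.
by apply: leq_trans (degree_le w u); apply/card_gt0P; exists v.
Qed.

Let Gam_ge0 : 0 <= Gam.
Proof. by rewrite /Gam divr_ge0 ?(ltW eps0) // mulr_ge0 // sqr_ge0. Qed.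

Let Gam_lambda : Gam <= lambda w / 2.
Proof.
move: gap; rewrite invfM mulrA -/Gam ltr_pdivrMr // => /ltW;
  rewrite mulrC mulrA mulr1.
by [].
Qed.

Let beta_large : (n0 <= n)%N -> 2 * beta <= Gam.
Proof.
move=> nn; rewrite /beta ltnNge nn /= /Gam /T /threshold.
(* The choice of [n0]: one of the two logarithms in [Gam] dominates the constant [4 * tau]. *)
have l4 : 4 * tau%:R <= ln n%:R :> R.
  rewrite -(expRK (4 * tau%:R)) ler_ln ?posrE ?expR_gt0 ?ltr0n ?(ltnW n1) //.
  by apply: le_trans n0P _; rewrite ler_nat.
have -> : 2 * (2 * (tau%:R * (ln n%:R / eps)) * (max_degree w)%:R) =
  (max_degree w)%:R * (4 * tau%:R * ln n%:R) / eps by ring.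
by rewrite ler_pM2r ?invr_gt0 // ler_wpM2l // expr2 ler_pM2r.
Qed.

Let beta_le : beta <= (1 + 2 * tau%:R * n0%:R / ln 2) * Gam.
Proof.
have l2 : 0 < ln 2 :> R by rewrite ln_gt0 // ltr1n.
have l2n : ln 2 <= ln n%:R :> R by rewrite ler_ln ?posrE ?ltr0n ?(ltnW n1) //
  ler_nat.
rewrite mulrDl mul1r; case: (leqP n0 n) => nn.
  have := beta_large nn; have : 0 <= 2 * tau%:R * n0%:R / ln 2 * Gam.
    by rewrite mulr_ge0 // divr_ge0 ?mulr_ge0 // ltW.
  have := Gam_ge0; lra.
rewrite -[leLHS]add0r lerD // /beta nn /T /threshold.
apply: (@le_trans _ _ (2 * tau%:R * n0%:R / ln 2 * (1 * (ln 2 * ln n%:R) /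
  eps))).
  rewrite (_ : 2 * tau%:R * n0%:R / ln 2 * _ = 2 * (tau%:R * (ln n%:R / eps)) *
    n0%:R); last first.
    by field; rewrite !gt_eqF.
  rewrite ler_wpM2l ?ler_nat ?(ltnW nn) // mulr_ge0 // ltW //.
rewrite ler_wpM2l ?divr_ge0 ?mulr_ge0 ?(ltW l2) // /Gam ler_pM2r ?invr_gt0 //.
by rewrite ler_pM ?ler1n ?mulr_ge0 ?(ltW l2) ?(ltW ln0) // expr2 ler_pM2r.
Qed.

Let ray' x : vsum x = 0 -> lambda w / 2 * dot x x <= energy wt' x x.
Proof.
move=> /ray rx; have d0 := dot_ge0 x.
case: (leqP n0 n) => nn; last first.
  apply: (@le_trans _ _ (energy w x x)).
    by apply: le_trans rx; rewrite ler_wpM2r // ler_pdivrMr // ler_pMr // ler1n.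
  by apply: ler_sum => e _; rewrite ler_wpM2r ?wt'_ge // -expr2 sqr_ge0.
have b0 : nonneg_wvec b by move=> e; exact: le_trans (wt'_close e).
have eb := energy_le_degree x b0 b_degree.
have : energy w x x - energy b x x <= energy wt' x x.
  rewrite /energy -sumrB; apply: ler_sum => e _; rewrite -mulrBl ler_wpM2r //.
    by rewrite -expr2 sqr_ge0.
  by have := wt'_close e; rewrite ler_norml => /andP[]; lra.
(* The change of energy is at most [2 * beta * dot x x], and [2 * beta <= Gam <= lambda w / 2]: half
   of the gap survives. *)
have : 2 * beta * dot x x <= lambda w / 2 * dot x x.
  by rewrite ler_wpM2r // (le_trans (beta_large nn)).
by lra.
Qed.

Lemma good_tape_accurate (u v : 'I_n) : u != v ->
  (`| (estimate wt n u v)%:E - commute_time w u v |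
   <= (accuracy_cst * (norm1 w / lambda w ^+ 2 * Gam))%:E)%E.
Proof.
move=> uv; have [y [y0 yL ->]] := commute_timeE n1 w0 cw uv.
have dwt : definite wt'.
  move=> x /ray' rx e0; rewrite e0 in rx; apply: dot_eq0.
  apply/eqP; rewrite eq_le dot_ge0 andbT -(ler_pM2l (_ : 0 < lambda w / 2))
    ?mulr0 //.
  by rewrite divr_gt0.
have [y' [y'0 y'L ->]] := estimateE (ltnW n1) wt'_ge0 dwt uv.
rewrite -EFinB lee_fin.
have P := commute_perturbation n1 lambda0 w0 wt'_ge0 wt'_close b_degree ray ray'
  y0 y'0 (dot_pair_pair R uv) yL y'L.
have -> : forall p q : R, 2 + p - (2 + q) = p - q by move=> p q; ring.
apply: le_trans P _.
have -> : norm1 w = \sum_e w e by apply: eq_bigr => e _; rewrite ger0_norm.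
have W0 : 0 <= \sum_e w e by exact: sumr_ge0.
have -> : accuracy_cst * ((\sum_e w e) / lambda w ^+ 2 * Gam) =
  36 * (\sum_e w e) * ((1 + 2 * tau%:R * n0%:R / ln 2) * Gam) / lambda w ^+ 2.
  by rewrite /accuracy_cst; ring.
by rewrite ler_pM2r ?invr_gt0 ?exprn_gt0 // ler_wpM2l // mulr_ge0.
Qed.

End OnGoodTapes.

Lemma commute_timeC n (w : wvec R n) u v : commute_time w u v = commute_time w
  v u.
Proof. by rewrite /commute_time addeC. Qed.

Lemma program_accurate (a n : nat) (eps : R) (w : wvec R n) :
  tau = a.+3 -> 0 < eps -> nonneg_wvec w -> connected_graph w ->
  (max_degree w)%:R * ln n%:R ^+ 2 / (eps * lambda w) < 1 / 2 ->
  ((1 - (n%:R ^+ a)^-1)%:E <=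
     tape_law R time_poly.[n]
       [set tape | forall u v : 'I_n, u != v ->
          (`| (edge_coord (output (program tau n0) eps w tape) u v)%:E - commute_time w u v |
           <= (accuracy_cst * (norm1 w / lambda w ^+ 2
                * ((max_degree w)%:R * ln n%:R ^+ 2 / eps)))%:E)%E])%E.
Proof.
move=> tauE eps0 w0 cw gap; set T := time_poly.[n]; set K := accuracy_cst * _.
set G := (X in tape_law R T X).
have [n1|n1] := leqP n 1.
  have -> : G = setT.
    apply/seteqP; split=> // tape _ u v /eqP[]; apply: ord_inj.
    by move: (ltn_ord u) (ltn_ord v) n1; lia.
  by rewrite [leRHS]probability_setT lee_fin gerBl invr_ge0 exprn_ge0.
have nT : (time_bound n <= T)%N by rewrite /T time_polyE.
have nnT : (n * n <= T)%N by apply: leq_trans nT; rewrite /time_bound; lia.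
have npos : 0 < n%:R :> R by rewrite ltr0n ltnW.
(* Between [d] and [1 - d] the logit is at most [tau * ln n] in absolute value, so the noise is at
   most the threshold. *)
pose d : R := (1 + n%:R ^+ tau)^-1.
have np0 : 0 < n%:R ^+ tau :> R by rewrite exprn_gt0.
have d0 : 0 <= d by rewrite invr_ge0 addr_ge0 // ltW.
have np1 : 1 <= n%:R ^+ tau :> R by rewrite exprn_ege1 // ler1n ltnW.
have d2 : d <= 1 / 2 by rewrite div1r lef_pV2 ?posrE // ?addr_gt0 //; lra.
pose bad i := [set tape : T.-tuple RR | (~` `[d, 1 - d]%classic) (nth 0 tape
  i)].
have mC : @measurable _ RR (~` `[d, 1 - d]%classic) by apply: measurableC.
have mbad i : measurable (bad i).
  by have := @measurable_nth_tuple R T i measurableT _ mC; rewrite setTI.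
pose Bad := \big[setU/set0]_(i < n * n) bad i.
have mBad : measurable Bad by apply: bigsetU_measurable => i _; exact: mbad.
have PBad : (tape_law R T Bad <= (n%:R ^+ a)^-1%:E)%E.
  apply: le_trans (Boole_inequality _ _) _ => [i _|]; first exact: mbad.
  rewrite (eq_bigr (fun=> (2 * d)%:E)) => [|i _]; last first.
    rewrite -uniform01_itvC //; apply: tape_law_coord => //.
    exact: leq_trans (ltn_ord i) nnT.
  rewrite sumEFin lee_fin sumr_const card_ord -[_ *+ (n * n)]mulr_natl natrM.
  (* Union bound over [n^2] variates: with [tau = a + 3] the total is [2 / n] times [n^-a], and
     [2 / n <= 1]. *)
  apply: (@le_trans _ _ (n%:R * n%:R * (2 * (n%:R ^+ tau)^-1))).
    rewrite ler_wpM2l ?mulr_ge0 // ler_wpM2l // lef_pV2 ?posrE ?addr_gt0 //.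
    by rewrite lerDr.
  rewrite tauE !exprS.
  have n2 : 2 <= n%:R :> R by rewrite ler_nat.
  rewrite (_ : _ * _ = 2 / n%:R * (n%:R ^+ a)^-1); last first.
    by field; rewrite !gt_eqF ?exprn_gt0.
  by rewrite -[leRHS]mul1r ler_wpM2r ?invr_ge0 ?exprn_ge0 // ler_pdivrMr //
    mul1r.
have mG : measurable G.
  rewrite (_ : G = \bigcap_(p in [set: 'I_n * 'I_n]) [set tape : T.-tuple RR |
      p.1 != p.2 -> (`| (edge_coord (output (program tau n0) eps w tape) p.1
        p.2)%:E
         - commute_time w p.1 p.2 | <= K%:E)%E]); last first.
    apply/seteqP; split=> tape H; first by move=> [u v] _; exact: H.
    by move=> u v; exact: (H (u, v)).
  apply: fin_bigcap_measurable => // -[u v] _ /=.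
  have [->|uv] := eqVneq u v.
    by rewrite (_ : [set _ | _] = setT) //; apply/seteqP; split.
  (* Commute times being finite, the event for one pair is that a single output coordinate lies in a
     closed interval. *)
  have [y [_ _ ->]] := commute_timeE n1 w0 cw uv.
  set c := 2 + _.
  have [e [_ eP]] := edge_coord_some w uv.
  have outE x : edge_coord x u v = x e.
    by case: eP => -[-> ->]; rewrite ?edge_coordE ?edge_coordE'.
  rewrite (_ : [set _ | _] = (fun tape : T.-tuple R => output (program tau n0)
    eps w tape e)
     @^-1` `[c - K, c + K]%classic).
    have mI : @measurable _ RR `[c - K, c + K]%classic by [].
    by have := @measurable_output_coord R T _ n eps w e (program_oblivious tau
      n0) measurableT _ mI; rewrite setTI.
  apply/seteqP; split=> tape /=; rewrite outE lee_fin ler_distl in_itv /=.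
  - by apply.
  - by move=> H _.
apply: (@le_trans _ _ (tape_law R T (~` Bad))).
  rewrite probability_setC // EFinB leeB //.
apply: le_measure; rewrite ?inE //; first exact: measurableC.
move=> tape nbad u v uv.
have good i : (i < n * n)%N -> d <= tape`_i <= 1 - d.
  move=> ii; apply/negPn/negP => H; apply: nbad; rewrite /Bad -bigcup_mkord.
  by exists i => //; rewrite /bad /= in_itv /=; exact/negP.
wlog : u v uv / (u < v)%N.
  move=> W; have := uv; rewrite neq_ltn => /orP[|vu]; first exact: W.
  by rewrite edge_coordC commute_timeC; apply: W => //; rewrite eq_sym.
move=> luv; pose e : upair n := exist _ (u, v) luv.
rewrite (edge_coordE _ e) /output /=.
have [_ ->] := @run_program R tau n0 n T eps w tape nT; rewrite ?ltn_ord //.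
by apply: good_tape_accurate => //; rewrite tauE.
Qed.

End Accuracy.

Theorem theorem5p10 (R : realType) (a : nat) (c : R) (c_gt0 : 0 < c) :
  exists2 K : R, 0 < K &
  forall eps : R, 0 < eps ->
  exists (A : cmd) (p : {poly nat}), forall n : nat,
    [/\ runs_in_time A p.[n] n eps,
        measurable_mechanism (@output R A p.[n] n eps),
        differentially_private (tape_law R p.[n]) eps 0
          (@output R A p.[n] n eps)
      & forall w : wvec R n, nonneg_wvec w -> connected_graph w ->
        c * ((max_degree w)%:R * ln n%:R ^+ 2 / eps) <= lambda w ->
        (max_degree w)%:R * ln n%:R ^+ 2 / (eps * lambda w) < 1 / 2 ->
        ((1 - (n%:R ^+ a)^-1)%:E <=
         tape_law R p.[n]
           [set tape | forall u v : 'I_n, u != v ->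
              (`| (edge_coord (output A eps w tape) u v)%:E - commute_time w u v |
               <= (K * (norm1 w / lambda w ^+ 2
                        * ((max_degree w)%:R * ln n%:R ^+ 2 / eps)))%:E)%E])%E].
Proof.
pose tau := a.+3.
have [n0 n0P] : exists n0 : nat, expR (4 * tau%:R) <= n0%:R :> R.
  by eexists; apply/ltW/archi_boundP; exact: expR_ge0.
exists (accuracy_cst R tau n0); first exact: accuracy_cst_gt0.
move=> eps eps0; exists (program tau n0), time_poly => n; split.
- move=> w _ tape; have [] // := @run_program R tau n0 n time_poly.[n] eps w
  tape.
  by rewrite time_polyE.
- exact: oblivious_measurable (program_oblivious tau n0).
- exact: program_private.
- by move=> w w0 cw _ gap; exact: program_accurate.
Qed.
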